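(* Let $n\ge 1$ and $1\le k\le n$ be integers, and let $\mathcal V=\{V_1,\dots,V_N\}$ be any set of $N\ge 1$ $k$-dimensional linear subspaces of $\mathbb{R}^n$. Then \[ w_G\Big(B_H\big(\mathbf{S}_+^{n,k}(\mathcal V)^*\big)\Big)\;\le\;\sqrt{2k}+\sqrt{2\log N}. \]
   Context: $\mathbf S^n$ denotes the space of real symmetric $n\times n$ matrices with the trace inner product $\langle A,B\rangle=\mathrm{Tr}(AB)$. $H=\{X\in\mathbf S^n:\mathrm{Tr}\,X=1\}$. For a cone $\mathcal K\subseteq\mathbf S^n$, $B_H(\mathcal K):=(\mathcal K\cap H)-\tfrac1n I_n=\{X-\tfrac1nI_n: X\in\mathcal K\cap H\}$, and $\mathcal K^*=\{Y\in\mathbf S^n:\langle X,Y\rangle\ge 0\ \forall X\in\mathcal K\}$ is the dual cone. For $\mathcal V=\{V_1,\dots,V_N\}$ a set of $k$-dimensional subspaces of $\mathbb R^n$, the $k$-PSD approximation is the cone $\mathbf S_+^{n,k}(\mathcal V):=\{X\in\mathbf S^n: v^TXv\ge 0\ \forall v\in V_i,\ \forall i=1,\dots,N\}$. The standard Gaussian distribution on $\mathbf S^n$: a random matrix $G=(g_{ij})$ with $(g_{ij})_{i\le j}$ independent, $g_{ii}\sim N(0,1)$, $g_{ij}\sim N(0,1/2)$ for $i<j$. For a nonempty bounded set $S\subseteq\mathbf S^n$, its Gaussian width is $w_G(S)=\mathbb E_G\big[\sup_{X\in S}\langle G,X\rangle\big]$ with $G$ standard Gaussian in $\mathbf S^n$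 (this equals the Gaussian width computed in any linear subspace containing $S$ with its own standard Gaussian; $\log$ is the natural logarithm). *)

(* Defs.v *)
From HB Require Import structures.
From mathcomp Require Import all_boot all_order all_algebra.
From mathcomp Require Import all_classical all_reals all_analysis.
Set Implicit Arguments.
Unset Strict Implicit.
Unset Printing Implicit Defensive.
Import Order.TTheory GRing.Theory Num.Theory.
Local Open Scope classical_set_scope.
Local Open Scope ring_scope.

Section defs.
Variable R : realType.

Definition symmx (n : nat) (X : 'M[R]_n) : Prop := X^T = X.

Definition trip (n : nat) (A B : 'M[R]_n) : R := \tr (A *m B).

Definition qform (n : nat) (X : 'M[R]_n) (v : 'rV[R]_n) : R :=
  (v *m X *m v^T) 0 0.

Definition kpsd_cone (n N : nat) (V : 'I_N -> {vspace 'rV[R]_n}) : set 'M[R]_n :=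
  [set X | symmx X /\ forall i v, v \in V i -> 0 <= qform X v].

Definition dual_cone (n : nat) (K : set 'M[R]_n) : set 'M[R]_n :=
  [set Y | symmx Y /\ forall X, K X -> 0 <= trip X Y].

Definition BH (n : nat) (K : set 'M[R]_n) : set 'M[R]_n :=
  [set X - (n%:R^-1) *: 1%:M | X in [set X | K X /\ \tr X = 1]].

(* G : T -> S^n is a standard Gaussian random matrix on the probability space P:
   symmetric, measurable entries, (g_ij)_{i<=j} mutually independent,
   g_ii ~ N(0,1), g_ij ~ N(0,1/2) for i<j (normal_prob takes mean and std dev). *)
Definition std_gaussian_sym (n : nat) d (T : measurableType d)
    (P : probability T R) (G : T -> 'M[R]_n) : Prop :=
  [/\ forall t, symmx (G t),
      forall i j : 'I_n, measurable_fun setT (fun t => G t i j),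
      forall B : 'I_n -> 'I_n -> set R, (forall i j : 'I_n, measurable (B i j)) ->
        P [set t | forall i j : 'I_n, (i <= j)%N -> B i j (G t i j)] =
        (\prod_(i < n) \prod_(j < n | (i <= j)%N) P ((fun t => G t i j) @^-1` B i j))%E,
      forall (i : 'I_n) (B : set R), measurable B ->
        P ((fun t => G t i i) @^-1` B) = normal_prob 0 1 B
    & forall (i j : 'I_n) (B : set R), (i < j)%N -> measurable B ->
        P ((fun t => G t i j) @^-1` B) = normal_prob 0 (Num.sqrt (2^-1)) B].

Definition gaussian_width (n : nat) d (T : measurableType d)
    (P : probability T R) (G : T -> 'M[R]_n) (S : set 'M[R]_n) : \bar R :=
  (\int[P]_t ereal_sup [set (trip (G t) X)%:E | X in S])%E.

End defs.

(* Main.v *)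
(* If [lam I - G] is nonnegative on every [V_i] it belongs to the cone, so the
   supremum is at most [max_i M_i - tr G / n] with [M_i] the largest value of
   [v^T G v] on the unit sphere of [V_i].  For unit vectors [u, w],
   [<u,w>^2 + 1 >= 2 <u,w>] with equality when [u = w].  Hence, by Slepian's
   inequality applied to finite nets of the sphere, with [z] a standard normal
   variable and [g] a standard Gaussian vector of [V_i],
     [E exp (t (M_i + z)) <= E exp (t sqrt 2 |g|) <= exp (t sqrt (2 k) + t^2)],
   that is [E exp (t M_i) <= exp (t sqrt (2 k) + t^2 / 2)].  The bound on
   [E max_i M_i] follows by summing these moments over [i] and optimising in [t].

   Slepian's inequality is needed for [exp (t max_u x_u)] only, approximated by
   [(\sum_u exp (beta x_u))^alpha] with [alpha beta = t].  It is proved by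
   exchanging small independent increments of the two processes one by one. *)

(* Why [z] is added: [u^T G u] has variance 1 on the unit sphere and [sqrt 2 <g,u>] has variance 2,
   and [z] supplies the missing unit. Dividing its factor [exp (t^2 / 2)] out again halves the
   quadratic exponent, and this yields [sqrt (2 log N)] instead of [2 sqrt (log N)].

   Gaussian vectors occur only through iterated one-dimensional integrals of nonnegative functions,
   so Tonelli and explicit exponential moments replace integration by parts. Exchanging one of [m]
   increments of scale [m^(-1/2)] costs [O(m^(-3/2))] relative to the current value, hence
   [O(m^(-1/2))] in total.

   The width integrates a supremum over an uncountable set whose measurability is not established;
   it is dominated pointwise by a measurable function first. The net error is [delta] times a sum of
   [|G_ij|], unbounded but of finite mean. The order of choices is: [delta], the net and its size
   [p], [alpha] with [p^alpha] close to 1, and finally the number of increments. *)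
Require Import Defs.
From HB Require Import structures.
From mathcomp Require Import all_boot all_order all_algebra.
From mathcomp Require Import all_classical all_reals all_analysis.
From mathcomp Require Import measurable_realfun ring lra.
Set Implicit Arguments.
Unset Strict Implicit.
Unset Printing Implicit Defensive.
Import Order.TTheory GRing.Theory Num.Theory.
Import numFieldNormedType.Exports.
Local Open Scope classical_set_scope.
Local Open Scope ring_scope.

(** * Gaussian integrals on the line *)

Section gaussian_line.
Variable R : realType.
Local Notation leb := (@lebesgue_measure R).
Implicit Types (f : R -> \bar R) (m s : R).

Lemma measurable_EFin_normal_pdf m s :
  measurable_fun [set: R] (fun x => (normal_pdf m s x)%:E).
Proof. by apply/measurable_EFinP; exact: measurable_normal_pdf. Qed.

Lemma EFin_normal_pdf_ge0 m s x : (0 <= (normal_pdf m s x)%:E)%E.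
Proof. by rewrite lee_fin normal_pdf_ge0. Qed.

(** The Radon-Nikodym derivative of [normal_prob m s] and [normal_pdf m s] have the same integral
    over every measurable set, hence agree almost everywhere. *)
Lemma ge0_integral_normal_prob m s f : measurable_fun [set: R] f ->
  (forall x, 0 <= f x)%E ->
  (\int[normal_prob m s]_x f x = \int[leb]_x (f x * (normal_pdf m s x)%:E))%E.
Proof.
move=> mf f0.
rewrite -(Radon_Nikodym_SigmaFinite.change_of_variables
  (normal_prob_dominates m s))//.
apply: ae_eq_integral => //.
- apply: emeasurable_funM => //; apply: (measurable_int leb).
  exact/Radon_Nikodym_SigmaFinite.f_integrable/normal_prob_dominates.
- apply: emeasurable_funM => //.
  by apply/measurable_EFinP; exact: measurable_normal_pdf.
- apply: ae_eqe_mul2l => /=.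
  apply: integral_ae_eq => //=.
  + exact/Radon_Nikodym_SigmaFinite.f_integrable/normal_prob_dominates.
  + by apply/measurable_EFinP; exact: measurable_normal_pdf.
  + move=> E _ mE; rewrite -Radon_Nikodym_SigmaFinite.f_integral//.
    exact: normal_prob_dominates.
Qed.

(** The left-hand side is a measure in [A] that gives each interval []c, d]] its length, so
    uniqueness of Lebesgue measure applies. *)
Lemma lebesgue_measure_affine (a b : R) (A : set R) : 0 < a -> measurable A ->
  (a%:E * pushforward leb (fun x : measurableTypeR R => (a * x + b)%R : measurableTypeR R) A = leb A)%E.
Proof.
move=> a0 mA.
have mphi : measurable_fun setT (fun x : measurableTypeR R => (a * x + b)%R : measurableTypeR R).
  by apply: measurable_funD => //; exact: measurable_funM.
pose mu1 : {measure set (measurableTypeR R) -> \bar R} :=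
  mscale (NngNum (ltW a0)) (pushforward leb (fun x : measurableTypeR R => (a * x + b)%R : measurableTypeR R)).
rewrite -[LHS]/(mu1 mphi A); apply/esym/lebesgue_measure_unique => //= _ [[c d]] _ <-.
rewrite /mu1/= /mscale/= /pushforward.
rewrite (_ : _ @^-1` _ = `](c - b) / a, (d - b) / a]%classic); last first.
  apply/seteqP; split => x /=; rewrite !in_itv/=;
    by rewrite ltr_pdivrMr// ler_pdivlMr// ltrBlDr lerBrDr mulrC.
rewrite !lebesgue_measure_itv/= !lte_fin ltr_pM2r ?invr_gt0// ltrD2r.
case: ifPn => // _; last by rewrite mule0.
by rewrite -!EFinD -EFinM; congr EFin; field; rewrite gt_eqF.
Qed.

Lemma ge0_integral_affine (a b : R) f : 0 < a -> measurable_fun [set: R] f ->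
  (forall x, 0 <= f x)%E ->
  (\int[leb]_x f x = a%:E * \int[leb]_x f (a * x + b)%R)%E.
Proof.
move=> a0 mf f0.
have mphi : measurable_fun setT (fun x : measurableTypeR R => (a * x + b)%R : measurableTypeR R).
  by apply: measurable_funD => //; exact: measurable_funM.
pose mu1 : {measure set (measurableTypeR R) -> \bar R} :=
  mscale (NngNum (ltW a0)) (pushforward leb (fun x : measurableTypeR R => (a * x + b)%R : measurableTypeR R)).
rewrite (eq_measure_integral (mu1 mphi))/=; last first.
  by move=> A mA _; rewrite -(lebesgue_measure_affine b a0 mA).
rewrite ge0_integral_mscale//; congr (_ * _)%E.
by rewrite ge0_integral_pushforward.
Qed.

Lemma normal_pdf_affine (c a x : R) : 0 < a ->
  normal_pdf c a (a * x + c) = a^-1 * normal_pdf 0 1 x.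
Proof.
move=> a0; rewrite !normal_pdfE ?gt_eqF// /normal_peak /normal_fun.
rewrite expr1n addrK subr0 mulrA; congr (_ * expR _); last first.
  by field; rewrite gt_eqF.
rewrite -mulrnAr sqrtrM ?sqr_ge0// sqrtr_sqr gtr0_norm// invfM.
by rewrite mul1r.
Qed.

Lemma integral_normal_affine (c a : R) f : 0 < a ->
  measurable_fun [set: R] f -> (forall x, 0 <= f x)%E ->
  (\int[normal_prob c a]_x f x = \int[normal_prob 0 1]_x f (a * x + c)%R)%E.
Proof.
move=> a0 mf f0.
have mphi : measurable_fun [set: R] (fun x : R => a * x + c).
  by apply: measurable_funD => //; exact: measurable_funM.
have mfphi : measurable_fun [set: R] (fun x : R => f (a * x + c)).
  exact: measurableT_comp mf mphi.
rewrite (ge0_integral_normal_prob _ _ mf f0).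
rewrite (ge0_integral_normal_prob _ _ mfphi (fun x => f0 _)).
rewrite (ge0_integral_affine c a0 (f := fun x => (f x * (normal_pdf c a x)%:E)%E)).
- rewrite -(ge0_integralZl leb measurableT _ (k := a%:E)).
  + apply: eq_integral => x _; rewrite normal_pdf_affine// muleCA.
    by rewrite -EFinM mulrA divff ?mul1r ?gt_eqF.
  + apply: emeasurable_funM; first exact: mfphi.
    exact: measurableT_comp (measurable_EFin_normal_pdf c a) mphi.
  + by move=> x _; rewrite mule_ge0 ?EFin_normal_pdf_ge0 ?f0.
  + by rewrite lee_fin ltW.
- by apply: (emeasurable_funM mf); exact: measurable_EFin_normal_pdf.
- by move=> x; rewrite mule_ge0 ?EFin_normal_pdf_ge0 ?f0.
Qed.

Lemma integral_normal_pdfZ m s (k : R) : 0 <= k ->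
  (\int[leb]_x (k%:E * (normal_pdf m s x)%:E) = k%:E)%E.
Proof.
move=> k0; rewrite (ge0_integralZl leb measurableT).
- by rewrite integral_normal_pdf mule1.
- exact: measurable_EFin_normal_pdf.
- by move=> x _; exact: EFin_normal_pdf_ge0.
- by rewrite lee_fin.
Qed.

Lemma integral_normal_expR (s : R) :
  (\int[normal_prob 0 1]_x (expR (s * x))%:E = (expR (s ^+ 2 / 2))%:E)%E.
Proof.
rewrite (@ge0_integral_normal_prob 0 1 (fun x => (expR (s * x))%:E)).
- rewrite -[RHS](integral_normal_pdfZ s 1 (expR_ge0 _)).
  apply: eq_integral => x _; rewrite -!EFinM; congr EFin.
  rewrite !normal_pdfE ?oner_eq0// /normal_fun mulrCA [RHS]mulrCA; congr (_ * _).
  by rewrite -!expRD; congr expR; field.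
- by apply/measurable_EFinP/measurableT_comp => //; exact: measurable_funM.
- by move=> x; rewrite lee_fin expR_ge0.
Qed.

(** The integrand against the standard density is [(1 - s)^(-1/2)] times the centred normal density
    of variance [1 / (1 - s)]. *)
Lemma integral_normal_expR_sqr (s : R) : s < 1 ->
  (\int[normal_prob 0 1]_x (expR (s * x ^+ 2 / 2))%:E =
   ((Num.sqrt (1 - s))^-1)%:E)%E.
Proof.
move=> s1; have s0 : 0 < 1 - s by rewrite subr_gt0.
have q0 : 0 < Num.sqrt (1 - s) by rewrite sqrtr_gt0.
rewrite (@ge0_integral_normal_prob 0 1 (fun x => (expR (s * x ^+ 2 / 2))%:E)).
- rewrite -[RHS](@integral_normal_pdfZ 0 (Num.sqrt (1 - s))^-1); last first.
    by rewrite invr_ge0 ltW.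
  apply: eq_integral => x _; rewrite -!EFinM; congr EFin.
  rewrite !normal_pdfE ?oner_eq0 ?invr_eq0 ?gt_eqF// /normal_fun.
  rewrite /normal_peak mulrCA [RHS]mulrA; congr (_ * _); last first.
    rewrite -!expRD exprVn sqr_sqrtr ?(ltW s0)//; congr expR.
    by field; rewrite gt_eqF.
  rewrite expr1n mul1r -mulrnAr sqrtrM ?sqr_ge0// sqrtr_sqr gtr0_norm ?invr_gt0//.
  by rewrite invfM invrK mulrA mulVf ?mul1r ?gt_eqF.
- apply/measurable_EFinP/measurableT_comp => //; apply: measurable_funM => //.
  by apply: measurable_funM => //; exact: measurable_funX.
- by move=> x; rewrite lee_fin expR_ge0.
Qed.

(* Completing the square: the joint density of [(a x + b y, y)] factors as that
   of a standard normal variable times that of a conditional one. *)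
Lemma integral_normal_convolution (a b : R) f : 0 < a -> 0 < b ->
  a ^+ 2 + b ^+ 2 = 1 -> measurable_fun [set: R] f -> (forall x, 0 <= f x)%E ->
  (\int[normal_prob 0 1]_y \int[normal_prob 0 1]_x f (a * x + b * y)%R =
   \int[normal_prob 0 1]_x f x)%E.
Proof.
move=> a0 b0 ab mf f0.
pose h (z : R * R) := (f z.2 * (normal_pdf 0 1 z.2)%:E *
  (normal_pdf (b * z.2) a z.1)%:E)%E.
have mh : measurable_fun setT h.
  apply: emeasurable_funM.
    apply: emeasurable_funM; first exact: measurableT_comp.
    exact: (measurableT_comp (measurable_EFin_normal_pdf 0 1)).
  apply/measurable_EFinP; rewrite /normal_pdf gt_eqF//.
  apply: measurable_funM => //; apply: measurableT_comp => //.
  apply: measurable_funM => //; apply: measurableT_comp => //.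
  apply: measurable_funX; apply: measurable_funB => //.
  exact: measurable_funM.
have h0 z : (0 <= h z)%E.
  by rewrite mule_ge0 ?EFin_normal_pdf_ge0// mule_ge0 ?EFin_normal_pdf_ge0.
(* Since [a^2 + b^2 = 1], both sides are the density of a pair of standard normal variables with
   correlation [b], conditioned on either coordinate. *)
have pdfE x y : normal_pdf 0 1 x * normal_pdf (b * x) a y =
    normal_pdf 0 1 y * normal_pdf (b * y) a x.
  rewrite !normal_pdfE ?oner_eq0 ?gt_eqF// [LHS]mulrACA [RHS]mulrACA.
  congr (_ * _); rewrite /normal_fun -!expRD; congr expR.
  have {}ab : b ^+ 2 = 1 - a ^+ 2 by rewrite -ab addrAC subrr add0r.
  apply: (mulIf (x := a ^+ 2 *+ 2)); first by rewrite mulrn_eq0/= expf_eq0/= gt_eqF.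
  rewrite !mulrDl !divfK ?mulrn_eq0 /= ?expf_eq0 /= ?gt_eqF//.
  transitivity (- ((x ^+ 2) * a ^+ 2 + (y - b * x) ^+ 2)); first by field.
  transitivity (- ((y ^+ 2) * a ^+ 2 + (x - b * y) ^+ 2)); last by field.
  by rewrite !sqrrB !exprMn ab; ring.
have mfab : measurable_fun [set: R * R] (fun z : R * R => f (a * z.2 + b * z.1)).
  apply: (measurableT_comp mf).
  by apply: measurable_funD; exact: measurable_funM.
transitivity (\int[leb]_y \int[leb]_x h (y, x))%E.
  rewrite ge0_integral_normal_prob.
  - apply: eq_integral => y _.
    rewrite -(@integral_normal_affine (b * y) a f a0 mf f0).
    rewrite (ge0_integral_normal_prob _ _ mf f0) muleC.
    rewrite -(ge0_integralZl leb measurableT _ (k := (normal_pdf 0 1 y)%:E)).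
    + apply: eq_integral => x _; rewrite /h/= muleCA -muleA; congr (_ * _)%E.
      by rewrite -!EFinM pdfE.
    + by apply: (emeasurable_funM mf); exact: measurable_EFin_normal_pdf.
    + by move=> x _; rewrite mule_ge0 ?EFin_normal_pdf_ge0.
    + exact: EFin_normal_pdf_ge0.
  - exact: (measurable_fun_fubini_tonelli_F
      (m2 := normal_prob 0 1) (fun z : R * R => f (a * z.2 + b * z.1)) mfab (fun z => f0 _)).
  - by move=> y; apply: integral_ge0 => x _; exact: f0.
rewrite (fubini_tonelli (m1 := leb) (m2 := leb) h mh h0) (ge0_integral_normal_prob _ _ mf f0).
apply: eq_integral => x _; rewrite /h/= (ge0_integralZl leb measurableT).
- by rewrite integral_normal_pdf mule1.
- exact: measurable_EFin_normal_pdf.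
- by move=> y _; exact: EFin_normal_pdf_ge0.
- by rewrite mule_ge0 ?EFin_normal_pdf_ge0.
Qed.

End gaussian_line.

(** * Averaging over Gaussian vectors *)

Section gaussian_averaging.
Variables (R : realType) (p : nat).
Local Notation V := (p.-tuple R).
Local Notation gamma := (normal_prob (0 : R) 1).
Implicit Types (a b : 'I_p -> R) (l : seq ('I_p -> R)) (x : V) (F G : V -> \bar R).

Definition shift a (c : R) x : V := [tuple tnth x i + c * a i | i < p].

Definition gstep a F x := (\int[gamma]_c F (shift a c x))%E.

(* [gmean l F x] is the expectation of [F] at [x] plus the centred Gaussian
   vector [\sum_(a <- l) xi_a a] with independent standard [xi_a]; its covariance
   matrix is [cov l] below. *)
Definition gmean l F := foldr gstep F l.

Definition dilate (s : R) l := [seq (fun u => s * a u) | a <- l].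

Lemma measurable_shift a :
  measurable_fun [set: V * R] (fun z => shift a z.2 z.1).
Proof.
apply/measurable_fun_tnthP => i.
rewrite (_ : _ \o _ = fun z : V * R => tnth z.1 i + z.2 * a i); last first.
  by apply/funext => z /=; rewrite tnth_mktuple.
apply: measurable_funD; last exact: measurable_funM.
by apply: (measurableT_comp (measurable_tnth i)).
Qed.

Lemma measurable_shift_comp a F : measurable_fun setT F ->
  measurable_fun [set: V * R] (fun z => F (shift a z.2 z.1)).
Proof. by move=> mF; apply: measurableT_comp => //; exact: measurable_shift. Qed.

Lemma measurable_shift1 a x F : measurable_fun setT F ->
  measurable_fun [set: R] (fun c => F (shift a c x)).
Proof.
move=> mF; apply: (measurableT_comp (f := fun z : V * R => F (shift a z.2 z.1))
  (g := fun c => (x, c))); first exact: measurable_shift_comp.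
exact: pair1_measurable.
Qed.

Lemma shift_shift a x c d : shift a c (shift a d x) = shift a (c + d) x.
Proof. by apply: eq_from_tnth => i; rewrite !tnth_mktuple; ring. Qed.

Lemma shift_dilate a x s c : shift (fun u => s * a u) c x = shift a (s * c) x.
Proof. by apply: eq_from_tnth => i; rewrite !tnth_mktuple; ring. Qed.

Lemma shiftC a b x c d : shift a c (shift b d x) = shift b d (shift a c x).
Proof. by apply: eq_from_tnth => i; rewrite !tnth_mktuple; ring. Qed.

Lemma gstep_ge0 a F : (forall x, 0 <= F x)%E -> forall x, (0 <= gstep a F x)%E.
Proof. by move=> F0 x; exact: integral_ge0. Qed.

Lemma measurable_gstep a F : measurable_fun setT F -> (forall x, 0 <= F x)%E ->
  measurable_fun setT (gstep a F).
Proof.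
move=> mF F0.
exact: (measurable_fun_fubini_tonelli_F (m2 := gamma)
  (fun z : V * R => F (shift a z.2 z.1)) (measurable_shift_comp a mF) (fun z => F0 _)).
Qed.

Lemma gmean_ge0 l F : (forall x, 0 <= F x)%E -> forall x, (0 <= gmean l F x)%E.
Proof. by move=> F0; elim: l => //= a l IH; exact: gstep_ge0. Qed.

Lemma measurable_gmean l F : measurable_fun setT F -> (forall x, 0 <= F x)%E ->
  measurable_fun setT (gmean l F).
Proof.
move=> mF F0; elim: l => //= a l IH; apply: measurable_gstep => //.
exact: gmean_ge0.
Qed.

Lemma gstepC a b F : measurable_fun setT F -> (forall x, 0 <= F x)%E ->
  gstep a (gstep b F) = gstep b (gstep a F).
Proof.
move=> mF F0; apply/funext => x; rewrite /gstep.
rewrite (fubini_tonelli (m1 := gamma) (m2 := gamma)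
  (fun z : R * R => F (shift b z.2 (shift a z.1 x)))); last by move=> z; exact: F0.
  apply: eq_integral => c _; apply: eq_integral => d _.
  by rewrite shiftC.
apply: (measurableT_comp (f := fun z : V * R => F (shift b z.2 z.1))
  (g := fun z : R * R => (shift a z.1 x, z.2))).
  exact: measurable_shift_comp.
apply: measurable_fun_pair => //.
apply: (measurableT_comp (f := fun z : V * R => shift a z.2 z.1)
  (g := fun z : R * R => (x, z.1))); first exact: measurable_shift.
by apply: measurable_fun_pair.
Qed.

Lemma gstep_gmean a l F : measurable_fun setT F -> (forall x, 0 <= F x)%E ->
  gstep a (gmean l F) = gmean l (gstep a F).
Proof.
move=> mF F0; elim: l => //= b l <-; rewrite gstepC//.
- exact: measurable_gmean.
- exact: gmean_ge0.
Qed.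

Lemma gmeanC l l' F : measurable_fun setT F -> (forall x, 0 <= F x)%E ->
  gmean l (gmean l' F) = gmean l' (gmean l F).
Proof.
move=> mF F0; elim: l => //= b l ->; rewrite gstep_gmean//.
- exact: measurable_gmean.
- exact: gmean_ge0.
Qed.

Lemma gstep_sqrt a F (s t : R) : 0 < s -> 0 < t ->
  measurable_fun setT F -> (forall x, 0 <= F x)%E ->
  gstep (fun u => Num.sqrt s * a u) (gstep (fun u => Num.sqrt t * a u) F) =
  gstep (fun u => Num.sqrt (s + t) * a u) F.
Proof.
move=> s0 t0 mF F0; apply/funext => x; rewrite /gstep.
have st0 : 0 < s + t by rewrite addr_gt0.
have q0 : 0 < Num.sqrt (s + t) by rewrite sqrtr_gt0.
rewrite -[RHS](@integral_normal_convolution _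
  (Num.sqrt t / Num.sqrt (s + t)) (Num.sqrt s / Num.sqrt (s + t))).
- apply: eq_integral => c _; apply: eq_integral => d _.
  congr F; rewrite !shift_dilate shift_shift mulrDr; congr (shift _ (_ + _) _);
    by field; rewrite gt_eqF.
- by rewrite divr_gt0 ?sqrtr_gt0.
- by rewrite divr_gt0 ?sqrtr_gt0.
- rewrite !exprMn !exprVn !sqr_sqrtr ?ltW// -mulrDl addrC divff ?gt_eqF//.
- exact: measurable_shift1.
- by [].
Qed.

(** Variances of independent increments add. Commutation of steps brings the two increments along
    the same vector together, where [gstep_sqrt] merges them. This is what allows a Gaussian vector
    to be cut into small increments. *)
Lemma gmean_semigroup l F (s t : R) : 0 < s -> 0 < t ->
  measurable_fun setT F -> (forall x, 0 <= F x)%E ->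
  gmean (dilate (Num.sqrt s) l) (gmean (dilate (Num.sqrt t) l) F) =
  gmean (dilate (Num.sqrt (s + t)) l) F.
Proof.
move=> s0 t0 mF F0; elim: l => //= a l <-.
rewrite -gstep_gmean; last 2 first.
- exact: measurable_gmean.
- exact: gmean_ge0.
rewrite gstep_sqrt//.
- by apply: measurable_gmean; [exact: measurable_gmean|exact: gmean_ge0].
- by apply: gmean_ge0; exact: gmean_ge0.
Qed.

Lemma le_gstep a F G : measurable_fun setT F -> measurable_fun setT G ->
  (forall x, 0 <= F x)%E -> (forall x, F x <= G x)%E ->
  forall x, (gstep a F x <= gstep a G x)%E.
Proof.
move=> mF mG F0 FG x; apply: ge0_le_integral => //.
- exact: measurable_shift1.
- exact: measurable_shift1.
Qed.

Lemma le_gmean l F G : measurable_fun setT F -> measurable_fun setT G ->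
  (forall x, 0 <= F x)%E -> (forall x, F x <= G x)%E ->
  forall x, (gmean l F x <= gmean l G x)%E.
Proof.
move=> mF mG F0 FG; have G0 x : (0 <= G x)%E by exact: le_trans (F0 _) (FG _).
elim: l => //= a l IH; apply: le_gstep => //.
- exact: measurable_gmean.
- exact: measurable_gmean.
- exact: gmean_ge0.
Qed.

Lemma gmeanD l F G : measurable_fun setT F -> measurable_fun setT G ->
  (forall x, 0 <= F x)%E -> (forall x, 0 <= G x)%E ->
  gmean l (fun x => F x + G x)%E = (fun x => gmean l F x + gmean l G x)%E.
Proof.
move=> mF mG F0 G0; elim: l => //= a l ->; apply/funext => x; rewrite /gstep.
rewrite ge0_integralD//.
- by move=> c _; exact: gmean_ge0.
- by apply: measurable_shift1; exact: measurable_gmean.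
- by move=> c _; exact: gmean_ge0.
- by apply: measurable_shift1; exact: measurable_gmean.
Qed.

Lemma gmeanZ l F (k : R) : measurable_fun setT F ->
  (forall x, 0 <= F x)%E -> 0 <= k ->
  gmean l (fun x => k%:E * F x)%E = (fun x => k%:E * gmean l F x)%E.
Proof.
move=> mF F0 k0; elim: l => //= a l ->; apply/funext => x; rewrite /gstep.
rewrite ge0_integralZl//.
- by apply: measurable_shift1; exact: measurable_gmean.
- by move=> c _; exact: gmean_ge0.
Qed.

Lemma gmean_cst l (k : \bar R) : gmean l (fun=> k) = (fun=> k).
Proof.
elim: l => //= a l ->; apply/funext => x.
rewrite /gstep integral_cst//.
by rewrite [X in (_ * X)%E](probability_setT gamma) mule1.
Qed.

Lemma gmean_sum l (I : Type) (r : seq I) (F : I -> V -> \bar R) :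
  (forall i, measurable_fun setT (F i)) -> (forall i x, 0 <= F i x)%E ->
  gmean l (fun x => \sum_(i <- r) F i x)%E =
  (fun x => \sum_(i <- r) gmean l (F i) x)%E.
Proof.
move=> mF F0; elim: r => [|i r IH].
  under eq_fun do rewrite big_nil.
  by rewrite gmean_cst; apply/funext => x; rewrite big_nil.
under eq_fun do rewrite big_cons.
rewrite gmeanD//.
- by rewrite IH; apply/funext => x; rewrite big_cons.
- exact: emeasurable_sum.
- by move=> x; exact: sume_ge0.
Qed.

Lemma gmean_expR l (n : 'I_p -> R) x :
  gmean l (fun x => (expR (\sum_u n u * tnth x u))%:E) x =
  (expR (\sum_u n u * tnth x u + (\sum_(a <- l) (\sum_u n u * a u) ^+ 2) / 2))%:E.
Proof.
elim: l x => [|a l IH] x /=; first by rewrite big_nil mul0r addr0.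
rewrite /gstep; under eq_integral do rewrite IH.
rewrite big_cons.
pose K := expR (\sum_u n u * tnth x u + (\sum_(b <- l) (\sum_u n u * b u) ^+ 2) / 2).
transitivity (\int[gamma]_c (K%:E * (expR ((\sum_u n u * a u) * c))%:E))%E.
  apply: eq_integral => c _; rewrite -EFinM /K -expRD; congr (expR _)%:E.
  rewrite (_ : \sum_u n u * tnth (shift a c x) u =
    \sum_u n u * tnth x u + (\sum_u n u * a u) * c); first by ring.
  rewrite mulr_suml -big_split/=; apply: eq_bigr => u _.
  by rewrite tnth_mktuple; ring.
rewrite ge0_integralZl//.
- by rewrite integral_normal_expR -EFinM /K -expRD; congr (expR _)%:E; field.
- by apply/measurable_EFinP/measurableT_comp => //; exact: measurable_funM.
- by rewrite lee_fin expR_ge0.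
Qed.

End gaussian_averaging.

(** * Second-order expansion of powers *)

Section power_expansion.
Variable R : realType.
Implicit Types (f df : R -> R) (a w m : R).

(** The sign of [(c - 1) * (w - 1)] treats both sides of 1 uniformly and lets the lemma be applied
    again at [c]. That sign says nothing when [w = 1], whence the separate clause on [w <= 1]. *)
Lemma MVT_at1 f df m w : m < 1 -> m < w ->
  (forall x, m < x -> is_derive x 1 f (df x)) -> f 1 = 0 ->
  exists c, [/\ m < c, 0 <= (c - 1) * (w - 1), w <= 1 -> c <= 1 &
    f w = df c * (w - 1)].
Proof.
move=> m1 mw dfx f1.
have cf (x y : R) : m < x -> {within `[x, y], continuous f}.
  move=> mx; apply: derivable_within_continuous => z; rewrite in_itv/= => /andP[xz _].
  by apply: ex_derive; apply: dfx; exact: lt_le_trans xz.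
have [w1|w1|->] := ltgtP w 1; last by exists 1; rewrite subrr !mulr0 f1.
- have D x : x \in `]w, 1[ -> is_derive x 1 f (df x).
    by rewrite in_itv/= => /andP[wx _]; apply: dfx; exact: lt_trans wx.
  have [c] := MVT w1 D (cf _ _ mw); rewrite in_itv/= f1 sub0r => /andP[wc c1] E; exists c; split.
  + exact: lt_trans wc.
  + by rewrite mulr_le0// subr_le0 ltW.
  + by rewrite (ltW c1).
  + by rewrite -[LHS]opprK E; ring.
- have D x : x \in `]1, w[ -> is_derive x 1 f (df x).
    by rewrite in_itv/= => /andP[wx _]; apply: dfx; exact: lt_trans wx.
  have [c] := MVT w1 D (cf _ _ m1); rewrite in_itv/= f1 subr0 => /andP[wc c1] E; exists c; split => //.
  + exact: lt_trans wc.
  + by rewrite mulr_ge0// subr_ge0 ltW.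
Qed.

(** A convex function lies above its tangent at 1. *)
Lemma powR_tangent_le a w : a < 1 -> 0 < w ->
  1 - (2 - a) * (w - 1) <= w `^ (a - 2).
Proof.
move=> a1 w0.
pose f (x : R) := x `^ (a - 2) - (1 - (2 - a) * (x - 1)).
pose df (x : R) := (a - 2) * (x `^ (a - 3) - 1).
have fE (x : R) : 0 < x -> is_derive x 1 f (df x).
  move=> x0; have dp := is_derive1_powR (a - 2) x0.
  apply: is_derive_eq; rewrite /GRing.scale /df /=.
  by rewrite (_ : a - 2 - 1 = a - 3); ring.
have f1 : f 1 = 0 by rewrite /f powR1; ring.
have [c [c0 cw _ E]] := MVT_at1 ltr01 w0 fE f1.
rewrite -subr_ge0 -[leRHS]/(f w) E /df.
have a2 : a - 2 <= 0 by lra.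
have [c1|c1] := leP c 1.
- have : 1 <= c `^ (a - 3).
    rewrite -[leLHS](powRr0 c); apply: ger_powR; last lra.
    by rewrite c0.
  have [->|cne1] := eqVneq c 1; first by rewrite powR1 subrr mulr0 mul0r.
  have cm : c - 1 < 0 by rewrite subr_lt0 lt_neqAle cne1.
  have w1 : w - 1 <= 0 by rewrite -(nmulr_rge0 _ cm).
  by move=> P1; rewrite mulr_le0// mulr_le0_ge0// subr_ge0.
- have : c `^ (a - 3) <= 1.
    by rewrite -[leRHS](powRr0 c); apply: ler_powR; [exact: ltW|lra].
  have cm : 0 < c - 1 by rewrite subr_gt0.
  have w1 : 0 <= w - 1 by rewrite -(pmulr_rge0 _ cm).
  by move=> P1; rewrite mulr_ge0// mulr_le0// subr_le0.
Qed.

(** In fact [w^a] is below its cubic Taylor polynomial at 1: the difference [f] vanishes to first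
    order at 1 and [f'' >= 0] by [powR_tangent_le]. The cubic coefficient is then rounded up to
    1. *)
Lemma powR_le_quadratic a w : 0 < a -> a < 1 -> 0 < w ->
  w `^ a <= 1 + a * (w - 1) - a * (1 - a) / 2 * (w - 1) ^+ 2 + `|w - 1| ^+ 3.
Proof.
move=> a0 a1 w0.
pose k := a * (1 - a); have k0 : 0 <= k by rewrite mulr_ge0 ?subr_ge0 ?ltW.
pose f (x : R) := 1 + a * (x - 1) - k / 2 * (x - 1) ^+ 2
  + k * (2 - a) / 6 * (x - 1) ^+ 3 - x `^ a.
pose g (x : R) := a - k * (x - 1) + k * (2 - a) / 2 * (x - 1) ^+ 2 - a * x `^ (a - 1).
pose h (x : R) := - k + k * (2 - a) * (x - 1) + k * x `^ (a - 2).
have fE (x : R) : 0 < x -> is_derive x 1 f (g x).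
  move=> x0; have dp := is_derive1_powR a x0.
  by apply: is_derive_eq; rewrite /GRing.scale /g /=; field.
have gE (x : R) : 0 < x -> is_derive x 1 g (h x).
  move=> x0; have dp := is_derive1_powR (a - 1) x0.
  apply: is_derive_eq; rewrite /GRing.scale /h /=.
  by rewrite (_ : a - 1 - 1 = a - 2); [rewrite /k; field|ring].
have f1 : f 1 = 0 by rewrite /f powR1; ring.
have g1 : g 1 = 0 by rewrite /g powR1; ring.
have [c [c0 cw _ E]] := MVT_at1 ltr01 w0 fE f1.
have [d [d0 dc _ Eg]] := MVT_at1 ltr01 c0 gE g1.
have hd : 0 <= h d.
  have -> : h d = k * (d `^ (a - 2) - (1 - (2 - a) * (d - 1))) by rewrite /h; ring.
  by rewrite mulr_ge0// subr_ge0 powR_tangent_le.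
have : 0 <= f w by rewrite E Eg -mulrA mulr_ge0.
rewrite /f subr_ge0 => /le_trans; apply; rewrite -/k lerD2l.
rewrite (le_trans (ler_norm _))// normrM normrX ler_piMl ?exprn_ge0//.
rewrite ger0_norm; last by rewrite !mulr_ge0//; lra.
by rewrite /k; nra.
Qed.

Lemma powR_quadratic_le a w : 0 < a -> a < 1 -> 0 < w ->
  1 + a * (w - 1) - a * (1 - a) / 2 * (w - 1) ^+ 2 <= w `^ a + 8 * `|w - 1| ^+ 3.
Proof.
move=> a0 a1 w0.
pose k := a * (1 - a); have k0 : 0 <= k by rewrite mulr_ge0 ?subr_ge0 ?ltW.
have k1 : k <= 1 by rewrite /k; nra.
rewrite -/k.
(* The derivatives of [w^a] blow up at 0. For [w <= 1/2] the cubic term is at least 1, which already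
   exceeds the quadratic expansion. *)
have [w2|w2] := leP w (1 / 2).
  have : 0 <= w `^ a by exact: powR_ge0.
  have : (1 / 2) ^+ 3 <= `|w - 1| ^+ 3.
    have W : 1 / 2 <= `|w - 1| by rewrite ler0_norm; lra.
    by apply: lerXn2r; rewrite ?nnegrE//; lra.
  have : 0 <= k / 2 * (w - 1) ^+ 2 by rewrite mulr_ge0 ?sqr_ge0//; lra.
  have : a * (w - 1) <= 0 by rewrite pmulr_rle0//; lra.
  rewrite expr_div_n expr1n; lra.
(* Above 1 the second derivative [k (1 - x^(a-2))] of the difference is already nonnegative; below 1
   the cubic [(1 - x)^3] has to compensate it. *)
pose C : R := if w <= 1 then 1 else 0.
have C0 : 0 <= C by rewrite /C; case: ifP.
have Cw : C * (1 - w) ^+ 3 <= 8 * `|w - 1| ^+ 3.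
  rewrite (@le_trans _ _ (`|w - 1| ^+ 3))//; last by rewrite ler_peMl ?exprn_ge0// ler1n.
  rewrite (le_trans (ler_norm _))// normrM normrX distrC ler_piMl ?exprn_ge0//.
  by rewrite /C; case: ifP => _; rewrite ?normr0 ?normr1.
rewrite -subr_ge0; apply: le_trans (_ : 0 <= w `^ a -
  (1 + a * (w - 1) - k / 2 * (w - 1) ^+ 2) + C * (1 - w) ^+ 3) _; last lra.
pose f (x : R) := x `^ a - (1 + a * (x - 1) - k / 2 * (x - 1) ^+ 2) + C * (1 - x) ^+ 3.
pose g (x : R) := a * x `^ (a - 1) - (a - k * (x - 1)) - 3 * C * (1 - x) ^+ 2.
pose h (x : R) := - k * x `^ (a - 2) + k + 6 * C * (1 - x).
have m0 (x : R) : 1 / 2 < x -> 0 < x by move=> x2; lra.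
have fE (x : R) : 1 / 2 < x -> is_derive x 1 f (g x).
  move=> x0; have dp := is_derive1_powR a (m0 _ x0).
  by apply: is_derive_eq; rewrite /GRing.scale /g /=; field.
have gE (x : R) : 1 / 2 < x -> is_derive x 1 g (h x).
  move=> x0; have dp := is_derive1_powR (a - 1) (m0 _ x0).
  apply: is_derive_eq; rewrite /GRing.scale /h /=.
  by rewrite (_ : a - 1 - 1 = a - 2); [rewrite /k; ring|ring].
have f1 : f 1 = 0 by rewrite /f powR1; ring.
have g1 : g 1 = 0 by rewrite /g powR1; ring.
have m1 : 1 / 2 < 1 :> R by lra.
have [c [c0 cw cw1 E]] := MVT_at1 m1 w2 fE f1.
have [d [d0 dc dc1 Eg]] := MVT_at1 m1 c0 gE g1.
have [c1|cne1] := eqVneq c 1; first by rewrite -[leRHS]/(f w) E c1 g1 mul0r.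
rewrite -[leRHS]/(f w) E Eg -mulrA mulr_ge0// /h.
have [w1|w1] := leP w 1.
  have d1 : d <= 1 by apply: dc1; exact: cw1.
  have dp := m0 _ d0.
  have : d `^ (a - 2) <= d `^ (- 2) by apply: ger_powR; [rewrite dp|lra].
  have dE : d `^ (-2) = (d ^+ 2)^-1 by rewrite powR_invn// ltW.
  rewrite dE => dle.
  (* The right-hand side is the chord of the convex function [d^(-2)] on [[1/2, 1]]; its slope 6
     matches the second derivative of [(1 - x)^3]. *)
  have d2 : (d ^+ 2)^-1 <= 1 + 6 * (1 - d).
    rewrite invf_ple ?posrE ?exprn_gt0//; last lra.
    rewrite -[leLHS]mul1r ler_pdivrMr; last lra.
    have -> : d ^+ 2 * (1 + 6 * (1 - d)) = 1 + (1 - d) * (1 - 2 * (1 - d)) * (4 - 3 * (1 - d)) by ring.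
    by rewrite lerDl !mulr_ge0//; lra.
  have : k * (d `^ (a - 2) - 1) <= 1 * (6 * (1 - d)).
    apply: (@le_trans _ _ (k * (6 * (1 - d)))).
      by rewrite ler_wpM2l//; lra.
    by rewrite ler_wpM2r// mulr_ge0//; lra.
  rewrite /C w1; lra.
have c1 : 1 <= c by move: cw; rewrite pmulr_lge0 ?subr_ge0// subr_gt0.
have d1 : 1 <= d.
  by move: dc; rewrite pmulr_lge0 ?subr_ge0// subr_gt0 lt_neqAle eq_sym cne1.
have : d `^ (a - 2) <= 1 by rewrite -[leRHS](powRr0 d); apply: ler_powR; lra.
by rewrite /C (leNgt w) w1/=; nra.
Qed.

End power_expansion.

(** * Slepian's inequality for exponential moments *)

Section slepian.
Variables (R : realType) (p : nat) (alpha beta : R).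
Hypotheses (p_gt0 : (0 < p)%N) (alpha_gt0 : 0 < alpha) (alpha_lt1 : alpha < 1).
Local Notation V := (p.-tuple R).
Implicit Types (l : seq ('I_p -> R)) (x z : V).

Definition cov l (u w : 'I_p) : R := \sum_(a <- l) a u * a w.

Definition expsum x : R := \sum_u expR (beta * tnth x u).

(* With [t := alpha * beta] fixed and [beta] large this is a smooth substitute for
   [exp (t * max_u x_u)]; its mixed second derivatives are negative since
   [alpha < 1]. *)
Definition softmax x : \bar R := (expsum x `^ alpha)%:E.

Lemma cov_dilate s l u w : cov (dilate s l) u w = s ^+ 2 * cov l u w.
Proof.
rewrite /cov /dilate big_map mulr_sumr; apply: eq_bigr => a _.
by rewrite mulrACA expr2.
Qed.

Lemma cov_ge0 l u : 0 <= cov l u u.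
Proof. by apply: sumr_ge0 => a _; rewrite -expr2 sqr_ge0. Qed.

Lemma expsum_gt0 x : 0 < expsum x.
Proof.
rewrite /expsum; case: p p_gt0 x => // n _ x; rewrite big_ord_recl.
by rewrite ltr_pwDl ?expR_gt0// sumr_ge0// => i _; exact: expR_ge0.
Qed.

Lemma measurable_tnth_expR (n : R) u :
  measurable_fun [set: V] (fun z => expR (n * tnth z u)).
Proof.
apply: measurableT_comp => //; apply: measurable_funM => //.
exact: measurable_tnth.
Qed.

Lemma measurable_expsum : measurable_fun [set: V] expsum.
Proof. by apply: measurable_sum => u; exact: measurable_tnth_expR. Qed.

Lemma measurable_softmax : measurable_fun [set: V] softmax.
Proof.
apply/measurable_EFinP.
exact: (measurableT_comp (measurable_powR alpha) measurable_expsum).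
Qed.

Lemma softmax_ge0 x : (0 <= softmax x)%E.
Proof. by rewrite lee_fin powR_ge0. Qed.

Lemma gmean_expR1 l (n : R) u x :
  gmean l (fun z => (expR (n * tnth z u))%:E) x =
  (expR (n * tnth x u + n ^+ 2 * cov l u u / 2))%:E.
Proof.
have sE (y : 'I_p -> R) : \sum_w (if w == u then n else 0) * y w = n * y u.
  rewrite (bigD1 u)//= eqxx big1 ?addr0// => w wu.
  by rewrite (negPf wu) mul0r.
under [X in gmean l X]eq_fun do rewrite -(sE (tnth _)).
rewrite gmean_expR sE; congr (expR (_ + _ / 2))%:E.
rewrite /cov mulr_sumr; apply: eq_bigr => a _.
by rewrite sE exprMn expr2.
Qed.

Lemma gmean_expR2 l (n : R) u w x :
  gmean l (fun z => (expR (n * tnth z u) * expR (n * tnth z w))%:E) x =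
  (expR (n * tnth x u) * expR (n * tnth x w) *
   expR (n ^+ 2 * (cov l u u + cov l w w + 2 * cov l u w) / 2))%:E.
Proof.
(* The two indicators are added, so [u = w] is covered with coefficient [2 n]. *)
have sE (y : 'I_p -> R) :
    \sum_v ((v == u)%:R * n + (v == w)%:R * n) * y v = n * y u + n * y w.
  under eq_bigr do rewrite mulrDl; rewrite big_split/=.
  by congr (_ + _); [rewrite (bigD1 u)//=|rewrite (bigD1 w)//=];
    rewrite eqxx mul1r big1 ?addr0// => v /negPf ->; rewrite !mul0r.
under [X in gmean l X]eq_fun do rewrite -expRD -(sE (tnth _)).
rewrite gmean_expR sE -!expRD; congr (expR (_ + _ / 2))%:E.
rewrite /cov mulr_sumr -!big_split/= mulr_sumr; apply: eq_bigr => a _.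
by rewrite sE; ring.
Qed.

Definition weight x u : R := expR (beta * tnth x u) / expsum x.

(* [softmax z = softmax x * ratio x z ^ alpha], and the moments of [ratio x] under
   [gmean _ _ x] are explicit sums of exponentials of covariances. *)
Definition ratio x z : R := expsum z / expsum x.

Definition moment1 l x : R :=
  \sum_u weight x u * expR (beta ^+ 2 * cov l u u / 2).

Definition moment2 l x : R :=
  \sum_u \sum_w weight x u * weight x w *
    expR (beta ^+ 2 * (cov l u u + cov l w w + 2 * cov l u w) / 2).

Lemma weight_ge0 x u : 0 <= weight x u.
Proof. by rewrite divr_ge0 ?expR_ge0// ltW// expsum_gt0. Qed.

Lemma sum_weight x : \sum_u weight x u = 1.
Proof. by rewrite -mulr_suml divff// gt_eqF// expsum_gt0. Qed.

Lemma ratio_gt0 x z : 0 < ratio x z.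
Proof. by rewrite divr_gt0// expsum_gt0. Qed.

Lemma measurable_ratio x : measurable_fun [set: V] (ratio x).
Proof. by apply: measurable_funM => //; exact: measurable_expsum. Qed.

Lemma ratioE x z :
  ratio x z = \sum_u weight x u * expR (beta * (tnth z u - tnth x u)).
Proof.
rewrite /ratio mulr_suml; apply: eq_bigr => u _.
rewrite /weight mulrAC -expRD; congr (expR _ / _); ring.
Qed.

(** [gmeanD] is available for nonnegative functions, so a signed expansion is computed by first
    adding its negative terms to both sides. *)
Lemma adde_fin_eq (y : \bar R) (b c : R) : (y + b%:E = c%:E -> y = (c - b)%:E)%E.
Proof. by case: y => //= r [<-]; rewrite addrK. Qed.

Lemma gmean_ratio l x : gmean l (fun z => (ratio x z)%:E) x = (moment1 l x)%:E.
Proof.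
rewrite (_ : (fun z => _) = fun z => (\sum_u ((expsum x)^-1)%:E *
  (expR (beta * tnth z u))%:E)%E); last first.
  apply/funext => z; rewrite /ratio mulr_suml -sumEFin.
  by apply: eq_bigr => u _; rewrite mulrC EFinM.
have S0 : 0 <= (expsum x)^-1 by rewrite invr_ge0 ltW// expsum_gt0.
have mE u : measurable_fun [set: V] (fun z => (expR (beta * tnth z u))%:E).
  by apply/measurable_EFinP; exact: measurable_tnth_expR.
rewrite gmean_sum; last 2 first.
- by move=> u; apply: measurable_funeM; exact: mE.
- by move=> u z; rewrite mule_ge0 ?lee_fin ?expR_ge0.
rewrite /moment1 -sumEFin; apply: eq_bigr => u _.
rewrite gmeanZ//.
by rewrite gmean_expR1 -EFinM expRD /weight; congr EFin; ring.
Qed.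

Lemma gmean_ratio_sqr l x :
  gmean l (fun z => (ratio x z ^+ 2)%:E) x = (moment2 l x)%:E.
Proof.
rewrite (_ : (fun z => _) = fun z => (\sum_u \sum_w ((expsum x)^-1 ^+ 2)%:E *
  (expR (beta * tnth z u) * expR (beta * tnth z w))%:E)%E); last first.
  apply/funext => z; rewrite /ratio exprMn expr2 mulr_suml mulr_suml -sumEFin.
  apply: eq_bigr => u _; rewrite mulr_sumr mulr_suml -sumEFin.
  by apply: eq_bigr => w _; rewrite mulrC EFinM.
have S0 : 0 <= (expsum x)^-1 ^+ 2 by rewrite exprn_ge0// invr_ge0 ltW// expsum_gt0.
have mE u w : measurable_fun [set: V]
    (fun z => (expR (beta * tnth z u) * expR (beta * tnth z w))%:E).
  by apply/measurable_EFinP; apply: measurable_funM; exact: measurable_tnth_expR.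
have mE2 u w : measurable_fun [set: V] (fun z => ((expsum x)^-1 ^+ 2)%:E *
    (expR (beta * tnth z u) * expR (beta * tnth z w))%:E)%E.
  by apply: measurable_funeM; exact: mE.
have E0 u w z : (0 <= ((expsum x)^-1 ^+ 2)%:E *
    (expR (beta * tnth z u) * expR (beta * tnth z w))%:E)%E.
  by rewrite mule_ge0 ?lee_fin// mulr_ge0 ?expR_ge0.
rewrite gmean_sum; last 2 first.
- by move=> u; exact: emeasurable_sum.
- by move=> u z; exact: sume_ge0.
rewrite /moment2 -sumEFin; apply: eq_bigr => u _.
rewrite gmean_sum// -sumEFin; apply: eq_bigr => w _.
rewrite gmeanZ//.
by rewrite gmean_expR2 -EFinM /weight; congr EFin; ring.
Qed.

Lemma gmean_ratio_dev2 l x : gmean l (fun z => ((ratio x z - 1) ^+ 2)%:E) x =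
  (moment2 l x + 1 - 2 * moment1 l x)%:E.
Proof.
have mr := measurable_ratio x.
apply: adde_fin_eq.
transitivity (gmean l (fun z => ((ratio x z - 1) ^+ 2)%:E + 2%:E * (ratio x z)%:E)%E x).
  rewrite gmeanD//=.
  - rewrite gmeanZ//; first by rewrite gmean_ratio.
    + exact/measurable_EFinP.
    + by move=> z; rewrite lee_fin ltW// ratio_gt0.
  - by apply/measurable_EFinP; apply: measurable_funX; exact: measurable_funB.
  - by apply: measurable_funeM; exact/measurable_EFinP.
  - by move=> z; rewrite lee_fin sqr_ge0.
  - by move=> z; rewrite mule_ge0// lee_fin ltW// ratio_gt0.
transitivity (gmean l (fun z => (ratio x z ^+ 2)%:E + 1)%E x).
  congr gmean; apply/funext => z; rewrite -EFinM -!EFinD; congr EFin; ring.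
rewrite gmeanD//.
- by rewrite gmean_ratio_sqr gmean_cst.
- by apply/measurable_EFinP; exact: measurable_funX.
- by move=> z; rewrite lee_fin sqr_ge0.
Qed.

(** Binomial expansion of [(y - 1)^4] for a log-normal [y], whose [n]-th moment is [exp (n^2 v)];
    hence the factors 16, 9, 4 and 1. *)
Lemma gmean_expR_dev4 l u x :
  gmean l (fun z => ((expR (beta * (tnth z u - tnth x u)) - 1) ^+ 4)%:E) x =
  (let v := beta ^+ 2 * cov l u u / 2 in
   expR (16 * v) + 6 * expR (4 * v) + 1 - (4 * expR (9 * v) + 4 * expR v))%:E.
Proof.
pose e (n : R) z : \bar R := (expR (n * (tnth z u - tnth x u)))%:E.
have mf (n : R) : measurable_fun [set: V] (fun z => expR (n * (tnth z u - tnth x u))).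
  apply: measurableT_comp => //; apply: measurable_funM => //.
  by apply: measurable_funB => //; exact: measurable_tnth.
have me n : measurable_fun [set: V] (e n) by exact/measurable_EFinP.
have e0 n z : (0 <= e n z)%E by rewrite lee_fin expR_ge0.
have mke (k : R) n : measurable_fun [set: V] (fun z => k%:E * e n z)%E.
  exact: measurable_funeM.
have ke0 (k : R) n z : 0 <= k -> (0 <= k%:E * e n z)%E.
  by move=> k0; rewrite mule_ge0.
have gE n : gmean l (e n) x = (expR (n ^+ 2 * cov l u u / 2))%:E.
  rewrite (_ : e n = fun z => ((expR (- (n * tnth x u)))%:E * (expR (n * tnth z u))%:E)%E).
    rewrite gmeanZ ?expR_ge0//.
    - by rewrite gmean_expR1 -EFinM -expRD addKr.
    - by apply/measurable_EFinP; exact: measurable_tnth_expR.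
  by apply/funext => z; rewrite /e -EFinM -expRD; congr (expR _)%:E; ring.
have gkE (k : R) n : 0 <= k ->
    gmean l (fun z => k%:E * e n z)%E x = (k * expR (n ^+ 2 * cov l u u / 2))%:E.
  by move=> k0; rewrite gmeanZ// gE EFinM.
apply: adde_fin_eq.
transitivity (gmean l (fun z => ((expR (beta * (tnth z u - tnth x u)) - 1) ^+ 4)%:E +
    (4%:E * e (3 * beta)%R z + 4%:E * e beta z))%E x).
  rewrite gmeanD.
  - congr (_ + _)%E; rewrite gmeanD//; last 2 first.
    + by move=> z; exact: ke0.
    + by move=> z; exact: ke0.
    rewrite !gkE// -EFinD; congr (_%:E).
    by congr (4 * expR _ + 4 * expR _); field.
  - by apply/measurable_EFinP; apply: measurable_funX; exact: measurable_funB.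
  - exact: emeasurable_funD.
  - by move=> z; rewrite lee_fin exprn_even_ge0.
  - by move=> z; rewrite adde_ge0// ke0.
transitivity (gmean l (fun z => (e (4 * beta)%R z + 6%:E * e (2 * beta)%R z) + 1)%E x).
  congr gmean; apply/funext => z; rewrite /e -!EFinM -!EFinD; congr EFin.
  have E (n : nat) (t : R) : expR (n%:R * beta * t) = expR (beta * t) ^+ n.
    by rewrite -mulrA expRM_natl.
  by rewrite !E; ring.
rewrite gmeanD//.
- rewrite gmean_cst gmeanD//; last by move=> z; exact: ke0.
  by rewrite gE gkE// -!EFinD; congr (_ + _ * _ + _)%:E; congr expR; field.
- exact: emeasurable_funD.
- by move=> z; rewrite adde_ge0// ke0.
Qed.

End slepian.

(** * Fourth moment of the ratio around 1 *)

Section slepian_step.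
Variables (R : realType) (p : nat) (alpha beta : R).
Hypotheses (p_gt0 : (0 < p)%N) (alpha_gt0 : 0 < alpha) (alpha_lt1 : alpha < 1).
Local Notation V := (p.-tuple R).
Implicit Types (l : seq ('I_p -> R)) (x z : V).

Lemma expR_le_quadratic (t : R) : 0 <= t -> expR t <= 1 + t + t ^+ 2 * expR t.
Proof.
move=> t0; have le1 : expR t <= 1 + t * expR t.
  have : expR t * (1 - t) <= 1.
    rewrite -[leRHS](expRxMexpNx_1 t) ler_wpM2l ?expR_ge0//.
    by have := expR_ge1Dx (- t); lra.
  lra.
rewrite (le_trans le1)// -addrA lerD2l expr2 -mulrA -[X in X + _]mulr1 -mulrDr.
exact: ler_wpM2l.
Qed.

Lemma sqr_mean_le (q r : 'I_p -> R) : (forall u, 0 <= q u) -> \sum_u q u = 1 ->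
  (\sum_u q u * r u) ^+ 2 <= \sum_u q u * r u ^+ 2.
Proof.
move=> q0 q1; set m := \sum_u q u * r u.
have : 0 <= \sum_u q u * (r u - m) ^+ 2.
  by apply: sumr_ge0 => u _; rewrite mulr_ge0 ?sqr_ge0.
rewrite (_ : \sum_u _ = \sum_u q u * r u ^+ 2 - m ^+ 2); first by rewrite subr_ge0.
transitivity (\sum_u (q u * r u ^+ 2 - (2 * m) * (q u * r u) + m ^+ 2 * q u)).
  by apply: eq_bigr => u _; ring.
by rewrite big_split sumrB/= -!mulr_sumr q1 -/m; ring.
Qed.

(** The ratio is a weighted mean of log-normal factors with total weight 1; Jensen's inequality for
    squares is used twice. *)
Lemma ratio_dev4_le x z : (ratio beta x z - 1) ^+ 4 <=
  \sum_u weight beta x u * (expR (beta * (tnth z u - tnth x u)) - 1) ^+ 4.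
Proof.
have q0 u : 0 <= weight beta x u by exact: weight_ge0.
have q1 : \sum_u weight beta x u = 1 by exact: sum_weight.
pose r u := expR (beta * (tnth z u - tnth x u)) - 1.
have -> : ratio beta x z - 1 = \sum_u weight beta x u * r u.
  rewrite ratioE -{1}q1 -sumrB; apply: eq_bigr => u _; rewrite /r; ring.
rewrite -[4%N]/(2 * 2)%N exprM.
apply: (@le_trans _ _ ((\sum_u weight beta x u * r u ^+ 2) ^+ 2)).
  apply: lerXn2r; rewrite ?nnegrE ?sqr_ge0//.
    by apply: sumr_ge0 => u _; rewrite mulr_ge0 ?sqr_ge0.
  exact: sqr_mean_le.
rewrite (le_trans (sqr_mean_le _ q0 q1))//; apply: ler_sum => u _.
by rewrite -exprM.
Qed.

(** Constant and linear terms cancel: [1 + 6 + 1 = 4 + 4] and [16 + 24 = 36 + 4]. The quadratic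
    remainders of the two positive exponentials give [352 = 16^2 + 6 * 4^2]. *)
Lemma dev4_moment_le (v v0 : R) : 0 <= v -> v <= v0 ->
  expR (16 * v) + 6 * expR (4 * v) + 1 - (4 * expR (9 * v) + 4 * expR v) <=
  352 * v0 ^+ 2 * expR (16 * v0).
Proof.
move=> v_ge0 vv0.
have h16 : expR (16 * v) <= 1 + 16 * v + (16 * v) ^+ 2 * expR (16 * v0).
  rewrite (le_trans (expR_le_quadratic _))//; first by rewrite mulr_ge0.
  by rewrite lerD2l ler_wpM2l ?sqr_ge0// ler_expR; lra.
have h4 : expR (4 * v) <= 1 + 4 * v + (4 * v) ^+ 2 * expR (16 * v0).
  rewrite (le_trans (expR_le_quadratic _))//; first by rewrite mulr_ge0.
  by rewrite lerD2l ler_wpM2l ?sqr_ge0// ler_expR; lra.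
have h9 := expR_ge1Dx (9 * v).
have h1 := expR_ge1Dx v.
apply: (@le_trans _ _ (352 * v ^+ 2 * expR (16 * v0))).
  rewrite !exprMn in h16 h4; lra.
apply: ler_wpM2r; first exact: expR_ge0.
apply: ler_wpM2l; first exact: ler0n.
by apply: lerXn2r; rewrite ?nnegrE// (le_trans v_ge0).
Qed.

Lemma gmean_ratio_dev4 l x (v0 : R) :
  (forall u, beta ^+ 2 * cov l u u / 2 <= v0) ->
  (gmean l (fun z => ((ratio beta x z - 1) ^+ 4)%:E) x <=
   (352 * v0 ^+ 2 * expR (16 * v0))%:E)%E.
Proof.
move=> lev0.
have q0 u : 0 <= weight beta x u by exact: weight_ge0.
pose f u z : \bar R := ((expR (beta * (tnth z u - tnth x u)) - 1) ^+ 4)%:E.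
have mf u : measurable_fun [set: V] (f u).
  apply/measurable_EFinP; apply: measurable_funX; apply: measurable_funB => //.
  apply: measurableT_comp => //; apply: measurable_funM => //.
  by apply: measurable_funB => //; exact: measurable_tnth.
have f0 u z : (0 <= f u z)%E by rewrite lee_fin exprn_even_ge0.
have mqf u : measurable_fun [set: V] (fun z => (weight beta x u)%:E * f u z)%E.
  exact: measurable_funeM.
have qf0 u z : (0 <= (weight beta x u)%:E * f u z)%E.
  by apply: mule_ge0; [rewrite lee_fin|exact: f0].
pose S z := (\sum_u (weight beta x u)%:E * f u z)%E.
suff : (gmean l S x <= (352 * v0 ^+ 2 * expR (16 * v0))%:E)%E.
  apply: le_trans; apply: le_gmean.
  - apply/measurable_EFinP; apply: measurable_funX; apply: measurable_funB => //.
    exact: measurable_ratio.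
  - exact: emeasurable_sum.
  - by move=> z; rewrite lee_fin exprn_even_ge0.
  - move=> z; rewrite /S /f; under eq_bigr do rewrite -EFinM.
    by rewrite sumEFin lee_fin ratio_dev4_le.
rewrite /S gmean_sum//.
set B := (X in (_ <= X%:E)%E).
rewrite -[B]mul1r -(sum_weight beta p_gt0 x) mulr_suml -sumEFin.
apply: lee_sum => u _; rewrite gmeanZ// gmean_expR_dev4 -EFinM lee_fin.
apply: (ler_wpM2l (q0 u)); apply: (dev4_moment_le _ (lev0 u)).
by rewrite divr_ge0// mulr_ge0 ?sqr_ge0 ?cov_ge0.
Qed.

End slepian_step.

(** * Second-order bounds for one Gaussian increment *)

Section slepian_comparison.
Variables (R : realType) (p : nat) (alpha beta : R).
Hypotheses (p_gt0 : (0 < p)%N) (alpha_gt0 : 0 < alpha) (alpha_lt1 : alpha < 1).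
Local Notation V := (p.-tuple R).
Local Notation F := (@softmax R p alpha beta).
Local Notation W := (ratio beta).
Implicit Types (l : seq ('I_p -> R)) (x z : V).

(** Absolute third moments have no closed form here, so the Taylor remainder is traded for a fourth
    moment. When [e] is the scale of the increment and that moment is [O(e^4)], both terms are
    [O(e^3)]. *)
Lemma normr_cube_le (e t : R) : 0 < e -> `|t| ^+ 3 <= e ^+ 3 + e^-1 * t ^+ 4.
Proof.
move=> e0; have t4 : 0 <= e^-1 * t ^+ 4.
  by rewrite mulr_ge0 ?invr_ge0 ?(ltW e0)// exprn_even_ge0.
have [te|/ltW et] := leP `|t| e.
  by rewrite (@le_trans _ _ (e ^+ 3)) ?lerDl// lerXn2r ?nnegrE// ltW.
rewrite (@le_trans _ _ (e^-1 * t ^+ 4)) ?lerDr ?exprn_ge0 ?(ltW e0)//.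
rewrite mulrC ler_pdivlMr// -[leRHS]ger0_norm ?exprn_even_ge0// normrX (exprSr `|t| 3).
by rewrite ler_wpM2l ?exprn_ge0.
Qed.

(** Minus the second Taylor coefficient of [w^alpha] at 1. *)
Let k := alpha * (1 - alpha) / 2.

Let k_ge0 : 0 <= k.
Proof. by rewrite /k !mulr_ge0 ?subr_ge0 ?ltW. Qed.

Let Wa x z : \bar R := (W x z `^ alpha)%:E.
Let dev n x z : \bar R := ((W x z - 1) ^+ n)%:E.
(** The linear Taylor polynomial [1 + alpha (W - 1)], grouped into nonnegative terms so that
    [gmeanD] applies. *)
Let lin x z : \bar R := ((1 - alpha)%:E + alpha%:E * (W x z)%:E)%E.

Let measurable_Wa x : measurable_fun [set: V] (Wa x).
Proof.
apply/measurable_EFinP.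
exact: (measurableT_comp (measurable_powR alpha) (measurable_ratio beta x)).
Qed.

Let measurable_dev n x : measurable_fun [set: V] (dev n x).
Proof.
apply/measurable_EFinP; apply: measurable_funX; apply: measurable_funB => //.
exact: measurable_ratio.
Qed.

Let measurable_W x : measurable_fun [set: V] (fun z => (W x z)%:E).
Proof. by apply/measurable_EFinP; exact: measurable_ratio. Qed.

Let Wa_ge0 x z : (0 <= Wa x z)%E.
Proof. by rewrite lee_fin powR_ge0. Qed.

Let W_ge0 x z : (0 <= (W x z)%:E)%E.
Proof. by rewrite lee_fin ltW// ratio_gt0. Qed.

Let dev2_ge0 x z : (0 <= dev 2 x z)%E.
Proof. by rewrite lee_fin sqr_ge0. Qed.

Let dev4_ge0 x z : (0 <= dev 4 x z)%E.
Proof. by rewrite lee_fin exprn_even_ge0. Qed.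

Let measurableZ (c : R) (f : V -> \bar R) : measurable_fun setT f ->
  measurable_fun setT (fun z => c%:E * f z)%E.
Proof. by move=> mf; exact: measurable_funeM. Qed.

Let geZ (c : R) (f : V -> \bar R) : 0 <= c -> (forall z, 0 <= f z)%E ->
  forall z, (0 <= c%:E * f z)%E.
Proof. by move=> c0 f0 z; rewrite mule_ge0. Qed.

Let measurable_lin x : measurable_fun setT (lin x).
Proof. by apply: emeasurable_funD => //; exact: measurableZ. Qed.

Let lin_ge0 x z : (0 <= lin x z)%E.
Proof.
apply: adde_ge0; first by rewrite lee_fin subr_ge0 ltW.
by apply: mule_ge0; rewrite ?lee_fin ltW// ratio_gt0.
Qed.

Lemma gmean_lin l x :
  gmean l (lin x) x = (1 - alpha + alpha * moment1 beta l x)%:E.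
Proof.
rewrite gmeanD//.
- rewrite gmean_cst gmeanZ//; last exact: ltW.
  by rewrite gmean_ratio// -EFinM -EFinD.
- exact: measurableZ.
- by move=> z; rewrite lee_fin subr_ge0 ltW.
- by move=> z; apply: mule_ge0 => //; rewrite lee_fin ltW.
Qed.

Lemma gmean_main l x : gmean l (fun z => Wa x z + k%:E * dev 2 x z)%E x =
  (gmean l (Wa x) x +
   (k * (moment2 beta l x + 1 - 2 * moment1 beta l x))%:E)%E.
Proof.
rewrite gmeanD//.
- by rewrite gmeanZ// gmean_ratio_dev2// EFinM.
- exact: measurableZ.
- exact: geZ.
Qed.

Lemma gmean_err l x (c e v0 : R) : 0 <= c -> 0 < e ->
  (forall u, beta ^+ 2 * cov l u u / 2 <= v0) ->
  (gmean l (fun z => (c * e ^+ 3)%:E + (c / e)%:E * dev 4 x z) x <=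
   (c * e ^+ 3 + c / e * (352 * v0 ^+ 2 * expR (16 * v0)))%:E)%E.
Proof.
move=> c0 e0 lev0; have ce0 : 0 <= c / e by rewrite divr_ge0// ltW.
rewrite gmeanD//; last 3 first.
- exact: measurableZ.
- by move=> z; rewrite lee_fin mulr_ge0// exprn_ge0// ltW.
- exact: geZ.
rewrite gmean_cst gmeanZ// EFinD leeD2l// [leRHS]EFinM.
apply: lee_wpmul2l; first by rewrite lee_fin.
exact: gmean_ratio_dev4.
Qed.

Lemma measurable_err x c e :
  measurable_fun setT (fun z => (c * e ^+ 3)%:E + (c / e)%:E * dev 4 x z)%E.
Proof. by apply: emeasurable_funD => //; exact: measurableZ. Qed.

Lemma measurable_main x :
  measurable_fun setT (fun z => Wa x z + k%:E * dev 2 x z)%E.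
Proof. by apply: emeasurable_funD => //; exact: measurableZ. Qed.

Lemma err_ge0 x (c e : R) z : 0 <= c -> 0 < e ->
  (0 <= (c * e ^+ 3)%:E + (c / e)%:E * dev 4 x z)%E.
Proof.
move=> c0 e0; apply: adde_ge0.
  by rewrite lee_fin mulr_ge0// exprn_ge0// ltW.
by apply: mule_ge0 => //; rewrite lee_fin divr_ge0// ltW.
Qed.

Lemma main_ge0 x z : (0 <= Wa x z + k%:E * dev 2 x z)%E.
Proof. by apply: adde_ge0 => //; exact: geZ. Qed.

(** The negative quadratic term stands on the left, so that both sides are averages of nonnegative
    functions and [le_gmean] applies to the pointwise Taylor bound. *)
Lemma gmean_power_le l x (e v0 : R) : 0 < e ->
  (forall u, beta ^+ 2 * cov l u u / 2 <= v0) ->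
  (gmean l (Wa x) x +
    (k * (moment2 beta l x + 1 - 2 * moment1 beta l x))%:E <=
   (1 - alpha + alpha * moment1 beta l x +
    (1 * e ^+ 3 + 1 / e * (352 * v0 ^+ 2 * expR (16 * v0))))%:E)%E.
Proof.
move=> e0 lev0; rewrite -gmean_main EFinD -gmean_lin.
have := leeD2l (gmean l (lin x) x) (gmean_err x ler01 e0 lev0).
apply: le_trans.
rewrite -[leRHS]/((fun y => gmean l (lin x) y + gmean l (fun z =>
  (1 * e ^+ 3)%:E + (1 / e)%:E * dev 4 x z) y)%E x).
rewrite -gmeanD//; last 2 first.
- exact: measurable_err.
- by move=> z; exact: err_ge0.
apply: le_gmean.
- exact: measurable_main.
- by apply: emeasurable_funD => //; exact: measurable_err.
- exact: main_ge0.
- move=> z; rewrite /Wa /dev /lin -!EFinM -!EFinD lee_fin.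
  have := powR_le_quadratic alpha_gt0 alpha_lt1 (ratio_gt0 beta p_gt0 x z).
  have := normr_cube_le (W x z - 1) e0.
  rewrite -/k; lra.
Qed.

Lemma gmean_power_ge l x (e v0 : R) : 0 < e ->
  (forall u, beta ^+ 2 * cov l u u / 2 <= v0) ->
  ((1 - alpha + alpha * moment1 beta l x)%:E <=
   gmean l (Wa x) x +
    (k * (moment2 beta l x + 1 - 2 * moment1 beta l x))%:E +
    (8 * e ^+ 3 + 8 / e * (352 * v0 ^+ 2 * expR (16 * v0)))%:E)%E.
Proof.
move=> e0 lev0; rewrite -gmean_main -gmean_lin.
have := leeD2l (gmean l (fun z => Wa x z + k%:E * dev 2 x z)%E x)
  (gmean_err x (ler0n R 8) e0 lev0).
apply: le_trans.
rewrite -[leRHS]/((fun y => gmean l (fun z => Wa x z + k%:E * dev 2 x z)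
  y + gmean l (fun z => (8 * e ^+ 3)%:E + (8 / e)%:E * dev 4 x z) y)%E x).
rewrite -gmeanD//; last 4 first.
- exact: measurable_main.
- exact: measurable_err.
- exact: main_ge0.
- by move=> z; exact: err_ge0.
apply: le_gmean => //.
- by apply: emeasurable_funD; [exact: measurable_main|exact: measurable_err].
- move=> z; rewrite /Wa /dev /lin -!EFinM -!EFinD lee_fin.
  have := powR_quadratic_le alpha_gt0 alpha_lt1 (ratio_gt0 beta p_gt0 x z).
  have := normr_cube_le (W x z - 1) e0.
  rewrite -/k; lra.
Qed.

Lemma gmean_softmax l x :
  gmean l F x = (F x * gmean l (fun z => (W x z `^ alpha)%:E) x)%E.
Proof.
have FE : F = (fun z => (expsum beta x `^ alpha)%:E * Wa x z)%E.
  apply/funext => z; rewrite -EFinM -powRM ?ltW ?expsum_gt0 ?ratio_gt0//.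
  by rewrite mulrC divfK// gt_eqF// expsum_gt0.
by rewrite [in LHS]FE gmeanZ// powR_ge0.
Qed.

End slepian_comparison.

(** * Exchange of a single increment *)

Section slepian_inequality.
Variables (R : realType) (p : nat) (alpha beta : R).
Hypotheses (p_gt0 : (0 < p)%N) (alpha_gt0 : 0 < alpha) (alpha_lt1 : alpha < 1).
Local Notation V := (p.-tuple R).
Local Notation F := (@softmax R p alpha beta).
Implicit Types (l : seq ('I_p -> R)) (x z : V).

Let mF : measurable_fun [set: V] F.
Proof. exact: measurable_softmax. Qed.

Let F0 x : (0 <= F x)%E.
Proof. exact: softmax_ge0. Qed.

Lemma moment1_le l x (v0 : R) :
  (forall u, beta ^+ 2 * cov l u u / 2 <= v0) -> moment1 beta l x <= expR v0.
Proof.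
move=> lev0; rewrite -[leRHS]mul1r -(sum_weight beta p_gt0 x) mulr_suml.
by apply: ler_sum => u _; rewrite ler_wpM2l ?weight_ge0// ler_expR.
Qed.

Lemma moment_dev2_ge0 l x : 0 <= moment2 beta l x + 1 - 2 * moment1 beta l x.
Proof.
rewrite -lee_fin -gmean_ratio_dev2//; apply: gmean_ge0 => z.
by rewrite lee_fin sqr_ge0.
Qed.

(* Expanding [ratio ^ alpha] to second order, the linear terms agree for [lX] and
   [lY] and the quadratic term, which has a negative coefficient, is larger for
   [lX]; the remainder is controlled by the fourth moment of [ratio - 1], which
   is [O(e^4)]. *)
Lemma slepian_step lX lY :
  (forall u, cov lX u u = cov lY u u) ->
  (forall u w, cov lY u w <= cov lX u w) ->
  exists2 C : R, 0 <= C & forall (e : R) x, 0 < e -> e <= 1 ->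
  [/\ (gmean (dilate e lX) F x <=
        gmean (dilate e lY) F x + (C * e ^+ 3)%:E * F x)%E,
      (gmean (dilate e lX) F x <= (1 + C * e ^+ 2)%:E * F x)%E &
      (gmean (dilate e lY) F x <= (1 + C * e ^+ 2)%:E * F x)%E].
Proof.
move=> covE cov_le.
pose K := beta ^+ 2 * (\sum_u cov lX u u) / 2.
have sum_ge0 : 0 <= \sum_u cov lX u u by apply: sumr_ge0 => u _; exact: cov_ge0.
have K0 : 0 <= K by rewrite divr_ge0// mulr_ge0 ?sqr_ge0.
pose D := 352 * K ^+ 2 * expR (16 * K).
have D0 : 0 <= D.
  apply: mulr_ge0; last exact: expR_ge0.
  by apply: mulr_ge0; [exact: ler0n|exact: sqr_ge0].
(* The first two terms bound the growth of [moment1]; [9 = 1 + 8] collects the remainder constants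
   of the upper and lower Taylor bounds. *)
pose C := K + K ^+ 2 * expR K + 9 * (1 + D).
have KK0 : 0 <= K ^+ 2 * expR K by rewrite mulr_ge0 ?sqr_ge0 ?expR_ge0.
have C0 : 0 <= C by rewrite /C; lra.
exists C => // e x e0 e1.
have e_ge0 := ltW e0.
have e2_le1 : e ^+ 2 <= 1 by rewrite exprn_ile1.
have e2_ge0 : 0 <= e ^+ 2 by exact: sqr_ge0.
have e3_le2 : e ^+ 3 <= e ^+ 2 by rewrite (exprSr _ 2) ler_piMr.
have e3_ge0 : 0 <= e ^+ 3 by rewrite exprn_ge0.
pose v0 := K * e ^+ 2.
have v0_ge0 : 0 <= v0 by rewrite mulr_ge0.
have leK : v0 <= K by rewrite ler_piMr.
have lev l : (forall u, cov l u u = cov lX u u) -> forall u,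
    beta ^+ 2 * cov (dilate e l) u u / 2 <= v0.
  move=> lE u; rewrite cov_dilate lE /v0 /K.
  have : cov lX u u <= \sum_u cov lX u u.
    by rewrite (bigD1 u)//= lerDl sumr_ge0// => w _; exact: cov_ge0.
  have B0 : 0 <= beta ^+ 2 * e ^+ 2 / 2 by rewrite divr_ge0// mulr_ge0 ?sqr_ge0.
  move=> /(ler_wpM2l B0); lra.
pose B := 352 * v0 ^+ 2 * expR (16 * v0).
have errE (c : R) : 0 <= c -> c * e ^+ 3 + c / e * B <= c * (1 + D) * e ^+ 3.
  move=> c0; have -> : c / e * B = c * (352 * K ^+ 2 * e ^+ 3 * expR (16 * v0)).
    by rewrite /B /v0; field; rewrite gt_eqF.
  have DE : 352 * K ^+ 2 * e ^+ 3 * expR (16 * v0) <= D * e ^+ 3.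
    rewrite -[leLHS]mulrA (mulrC (e ^+ 3)) mulrA; apply: ler_wpM2r => //.
    apply: ler_wpM2l; last by rewrite ler_expR ler_wpM2l.
    by apply: mulr_ge0; [exact: ler0n|exact: sqr_ge0].
  rewrite -mulrDr -[leRHS]mulrA ler_wpM2l// [leRHS]mulrDl mul1r.
  by apply: lerD.
have covX u : cov lX u u = cov lX u u by [].
have covY u : cov lY u u = cov lX u u by rewrite covE.
have mE : moment1 beta (dilate e lY) x = moment1 beta (dilate e lX) x.
  by apply: eq_bigr => u _; rewrite !cov_dilate covY.
have m2_le : moment2 beta (dilate e lY) x <= moment2 beta (dilate e lX) x.
  apply: ler_sum => u _; apply: ler_sum => w _.
  apply: ler_wpM2l; first by rewrite mulr_ge0 ?weight_ge0.
  rewrite ler_expR !cov_dilate !covY; apply: ler_wpM2r => //.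
  apply: ler_wpM2l; first exact: sqr_ge0.
  by rewrite lerD2l; apply: ler_wpM2l => //; exact: ler_wpM2l.
have m_le : moment1 beta (dilate e lX) x <= 1 + (K + K ^+ 2 * expR K) * e ^+ 2.
  rewrite (le_trans (moment1_le _ (lev _ covX)))//.
  rewrite (le_trans (expR_le_quadratic v0_ge0))//.
  rewrite -addrA lerD2l mulrDl lerD2l /v0 exprMn -[leRHS]mulrA -[leLHS]mulrA.
  rewrite ler_wpM2l ?sqr_ge0// mulrC; apply: ler_pM; rewrite ?expR_ge0 ?exprn_ge0//.
    by rewrite ler_expR.
  by rewrite -[leRHS]mul1r expr2 ler_wpM2r.
have X1 := gmean_power_le p_gt0 alpha_gt0 alpha_lt1 x e0 (lev _ covX).
have Y1 := gmean_power_le p_gt0 alpha_gt0 alpha_lt1 x e0 (lev _ covY).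
have Y2 := gmean_power_ge p_gt0 alpha_gt0 alpha_lt1 x e0 (lev _ covY).
have dX := moment_dev2_ge0 (dilate e lX) x.
have dY := moment_dev2_ge0 (dilate e lY) x.
rewrite !gmean_softmax//.
pose a l := gmean (dilate e l) (fun z => (ratio beta x z `^ alpha)%:E) x.
have a0 l : (0 <= a l)%E by apply: gmean_ge0 => z; rewrite lee_fin powR_ge0.
(* By homogeneity the factor [F x] can be removed; errors relative to [F x] are what the telescoping
   can propagate. *)
suff [aXY aX aY] : [/\ (a lX <= a lY + (C * e ^+ 3)%:E)%E,
    (a lX <= (1 + C * e ^+ 2)%:E)%E & (a lY <= (1 + C * e ^+ 2)%:E)%E].
  split.
  - rewrite [X in (_ <= _ + X)%E]muleC -ge0_muleDr ?a0//; first exact: lee_wpmul2l.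
    by rewrite lee_fin mulr_ge0.
  - by rewrite [leRHS]muleC; exact: lee_wpmul2l.
  - by rewrite [leRHS]muleC; exact: lee_wpmul2l.
move: X1 Y1 Y2 (a0 lX) (a0 lY); rewrite mE -/(a lX) -/(a lY).
move: (errE 1 ler01) (errE 8 (ler0n _ _)); rewrite -/B.
set m := moment1 beta (dilate e lX) x in m_le dX *.
set m2X := moment2 beta (dilate e lX) x in m2_le dX *.
rewrite mE -/m in dY.
set m2Y := moment2 beta (dilate e lY) x in m2_le dY *.
have a1 : 0 <= 1 - alpha by rewrite subr_ge0 ltW.
pose kk := alpha * (1 - alpha) / 2.
have kk0 : 0 <= kk by rewrite !mulr_ge0// ltW.
have kX : 0 <= kk * (m2X + 1 - 2 * m) by rewrite mulr_ge0.
have kY : 0 <= kk * (m2Y + 1 - 2 * m) by rewrite mulr_ge0.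
have kXY : kk * (m2Y + 1 - 2 * m) <= kk * (m2X + 1 - 2 * m).
  by rewrite ler_wpM2l// lerD2r lerD2r.
have am : alpha * m <= alpha + (K + K ^+ 2 * expR K) * e ^+ 2.
  rewrite -[X in _ <= X + _]mulr1.
  have := ler_wpM2l (ltW alpha_gt0) m_le; rewrite mulrDr => /le_trans; apply.
  rewrite lerD2l; apply: ler_piMl; last exact: ltW.
  by apply: mulr_ge0 => //; exact: addr_ge0.
have Ce3 : C * e ^+ 3 = (K + K ^+ 2 * expR K) * e ^+ 3 + 9 * (1 + D) * e ^+ 3.
  by rewrite /C; ring.
have Ce2 : C * e ^+ 2 = (K + K ^+ 2 * expR K) * e ^+ 2 + 9 * (1 + D) * e ^+ 2.
  by rewrite /C; ring.
have De : (1 + D) * e ^+ 3 <= (1 + D) * e ^+ 2 by rewrite ler_wpM2l// addr_ge0.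
have De0 : 0 <= (1 + D) * e ^+ 3 by rewrite mulr_ge0// addr_ge0.
have KK : 0 <= (K + K ^+ 2 * expR K) * e ^+ 3 by rewrite mulr_ge0// addr_ge0.
rewrite -/kk Ce3 Ce2.
(* Nonnegativity and the upper Taylor bounds exclude infinite values; real arithmetic remains. *)
case: (a lX) => [aX| |]//; case: (a lY) => [aY| |]// e1' e8.
rewrite -!EFinD !lee_fin => X1 Y1 Y2 aX0 aY0; split; lra.
Qed.

End slepian_inequality.

(** * Exchange of all increments *)

Section slepian_telescoping.
Variables (R : realType) (p : nat) (alpha beta : R).
Hypotheses (p_gt0 : (0 < p)%N) (alpha_gt0 : 0 < alpha) (alpha_lt1 : alpha < 1).
Local Notation V := (p.-tuple R).
Local Notation F := (@softmax R p alpha beta).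
Implicit Types (l : seq ('I_p -> R)) (x z : V).

Let mF : measurable_fun [set: V] F.
Proof. exact: measurable_softmax. Qed.

Let F0 x : (0 <= F x)%E.
Proof. exact: softmax_ge0. Qed.

Let it l j := iter j (gmean l) F.

Let itE l j : it l j = gmean (flatten (nseq j l)) F.
Proof. by elim: j => // j IH; rewrite /it iterS -/(it l j) IH /gmean foldr_cat. Qed.

Let mit l j : measurable_fun [set: V] (it l j).
Proof. by rewrite itE; exact: measurable_gmean. Qed.

Let it0 l j x : (0 <= it l j x)%E.
Proof. by rewrite itE; exact: gmean_ge0. Qed.

Lemma iter_gmean_le l (c : R) j x : 0 <= c ->
  (forall x, gmean l F x <= c%:E * F x)%E -> (it l j x <= (c ^+ j)%:E * F x)%E.
Proof.
move=> c0 lec; elim: j x => [|j IH] x; first by rewrite expr0 mul1e.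
apply: (@le_trans _ _ (gmean l (fun y => (c ^+ j)%:E * F y)%E x)).
  apply: le_gmean; [exact: mit| |exact: it0|exact: IH].
  exact: measurable_funeM.
rewrite gmeanZ// ?exprn_ge0// exprSr EFinM -muleA.
by apply: lee_wpmul2l => //; rewrite lee_fin exprn_ge0.
Qed.

(* Replaces the [lX]-steps by [lY]-steps one at a time; the steps commute, so each
   replacement can be made next to [F], where the one-step bound applies. *)
Lemma iter_gmean_telescope lX lY (c eps : R) j x : 1 <= c -> 0 <= eps ->
  (forall x, gmean lX F x <= gmean lY F x + eps%:E * F x)%E ->
  (forall x, gmean lX F x <= c%:E * F x)%E ->
  (forall x, gmean lY F x <= c%:E * F x)%E ->
  (it lX j x <= it lY j x + (j%:R * eps * c ^+ j)%:E * F x)%E.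
Proof.
move=> c1 eps0 XY Xc Yc; have c0 : 0 <= c by rewrite (le_trans ler01).
elim: j x => [|j IH] x; first by rewrite mul0r mul0r mul0e adde0.
have dj0 : 0 <= j%:R * eps * c ^+ j by rewrite !mulr_ge0// exprn_ge0.
have mZ (k : R) : measurable_fun [set: V] (fun x => k%:E * F x)%E.
  exact: measurable_funeM.
have Z0 (k : R) : 0 <= k -> forall x, (0 <= k%:E * F x)%E.
  by move=> k0 y; rewrite mule_ge0.
have mg l f : measurable_fun [set: V] f -> (forall x, 0 <= f x)%E ->
    measurable_fun [set: V] (gmean l f) by exact: measurable_gmean.
apply: (@le_trans _ _ (gmean lX (fun y => it lY j y +
    (j%:R * eps * c ^+ j)%:E * F y)%E x)).
  apply: le_gmean; [exact: mit| |exact: it0|exact: IH].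
  exact: emeasurable_funD.
rewrite gmeanD//; last exact: Z0.
rewrite gmeanZ//.
apply: (@le_trans _ _ (it lY j.+1 x + eps%:E * it lY j x +
    (j%:R * eps * c ^+ j)%:E * (c%:E * F x))%E).
  apply: leeD; last by apply: lee_wpmul2l => //; rewrite lee_fin.
  have swap l f : measurable_fun [set: V] f -> (forall x, 0 <= f x)%E ->
      gmean l (gmean (flatten (nseq j lY)) f) = gmean (flatten (nseq j lY)) (gmean l f).
    by move=> mf f0; exact: gmeanC.
  rewrite /it iterS -/(it lY j) itE !swap//.
  apply: (@le_trans _ _ (gmean (flatten (nseq j lY))
      (fun y => gmean lY F y + eps%:E * F y)%E x)).
    apply: le_gmean => //.
    - exact: mg.
    - by apply: emeasurable_funD => //; exact: mg.
    - exact: gmean_ge0.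
  rewrite gmeanD//.
  - by rewrite gmeanZ.
  - exact: mg.
  - exact: gmean_ge0.
  - exact: Z0.
rewrite -addeA leeD2l//.
apply: (@le_trans _ _ (eps%:E * ((c ^+ j)%:E * F x) +
    (j%:R * eps * c ^+ j)%:E * (c%:E * F x))%E).
  rewrite leeD2r//; apply: lee_wpmul2l => //.
  exact: iter_gmean_le.
move: (F x) (F0 x) => y y0; rewrite !muleA -!EFinM -ge0_muleDl ?lee_fin ?mulr_ge0 ?exprn_ge0//.
rewrite -EFinD; apply: lee_wpmul2r => //; rewrite lee_fin.
rewrite -[X in _ <= X * _ * _]natr1 exprSr -!mulrA mulrDl mul1r addrC mulrA.
rewrite -mulrA lerD// ler_wpM2l// ler_peMr ?exprn_ge0//.
Qed.

End slepian_telescoping.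

(** * Limit of small increments *)

Section slepian.
Variables (R : realType) (p : nat) (alpha beta : R).
Hypotheses (p_gt0 : (0 < p)%N) (alpha_gt0 : 0 < alpha) (alpha_lt1 : alpha < 1).
Local Notation V := (p.-tuple R).
Local Notation F := (@softmax R p alpha beta).
Implicit Types (l : seq ('I_p -> R)) (x z : V).

Lemma iter_gmean_sqrt l (h : R) j : 0 < h ->
  iter j.+1 (gmean (dilate (Num.sqrt h) l)) F =
  gmean (dilate (Num.sqrt (j.+1%:R * h)) l) F.
Proof.
move=> h0; elim: j => [|j IH]; first by rewrite mul1r.
rewrite iterS IH gmean_semigroup//.
- by rewrite -[j.+2]add1n natrD mulrDl mul1r.
- by rewrite mulr_gt0.
- exact: measurable_softmax.
- exact: softmax_ge0.
Qed.

Lemma dilate1 l : dilate 1 l = l.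
Proof.
rewrite /dilate -[RHS]map_id; apply: eq_map => a; apply/funext => u.
by rewrite mul1r.
Qed.

(** Both processes are cut into [m + 1] increments of scale [(m + 1)^(-1/2)]. The one-step errors
    [C (m + 1)^(-3/2)], amplified by at most [(1 + C / (m + 1))^(m + 1) <= exp C], add up to a
    multiple of [(m + 1)^(-1/2)]. *)
Lemma slepian_softmax lX lY x :
  (forall u, cov lX u u = cov lY u u) ->
  (forall u w, cov lY u w <= cov lX u w) ->
  (gmean lX F x <= gmean lY F x)%E.
Proof.
move=> covE cov_le.
have [C C0 step] := slepian_step beta p_gt0 alpha_gt0 alpha_lt1 covE cov_le.
have F0 : 0 <= fine (F x) by exact: powR_ge0.
have main (m : nat) : (gmean lX F x <= gmean lY F x +
    (C * expR C * fine (F x) / Num.sqrt m.+1%:R)%:E)%E.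
  pose h : R := m.+1%:R^-1.
  have h0 : 0 < h by rewrite invr_gt0.
  have h1 : h <= 1 by rewrite invf_le1// ler1n.
  have e0 : 0 < Num.sqrt h by rewrite sqrtr_gt0.
  have e1 : Num.sqrt h <= 1 by rewrite -[leRHS]sqrtr1 ler_wsqrtr.
  have eh : Num.sqrt h ^+ 2 = h by rewrite sqr_sqrtr// ltW.
  have := @iter_gmean_telescope R p alpha beta (dilate (Num.sqrt h) lX)
    (dilate (Num.sqrt h) lY) (1 + C * Num.sqrt h ^+ 2) (C * Num.sqrt h ^+ 3) m.+1 x.
  rewrite !iter_gmean_sqrt// divff ?pnatr_eq0// sqrtr1 !dilate1.
  have c1 : 1 <= 1 + C * Num.sqrt h ^+ 2 by rewrite lerDl mulr_ge0 ?sqr_ge0.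
  have c3 : 0 <= C * Num.sqrt h ^+ 3 by rewrite mulr_ge0// exprn_ge0// ltW.
  move=> /(_ c1 c3) H.
  apply: le_trans (H _ _ _) _; try by move=> y; have [] := step _ y e0 e1.
  apply: leeD2l; rewrite lee_fin eh.
  have -> : m.+1%:R * (C * Num.sqrt h ^+ 3) = C / Num.sqrt m.+1%:R.
    rewrite mulrCA; congr (C * _).
    by rewrite exprS eh /h sqrtrV// mulrCA divff ?pnatr_eq0// mulr1.
  rewrite -[leRHS]mulrA [X in _ <= _ * X]mulrC [leRHS]mulrA.
  rewrite ler_wpM2r// [leRHS]mulrAC ler_wpM2l//.
    by rewrite divr_ge0// sqrtr_ge0.
  rewrite (@le_trans _ _ (expR (C * h) ^+ m.+1))//.
    by apply: lerXn2r; rewrite ?nnegrE ?expR_ge0 ?expR_ge1Dx// addr_ge0// mulr_ge0// ltW.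
  by rewrite -expRM_natr -mulrA mulVf ?mulr1// pnatr_eq0.
apply/lee_addgt0Pr => e e0.
pose Q := C * expR C * fine (F x).
have Q0 : 0 <= Q by rewrite !mulr_ge0// expR_ge0.
pose m := Num.bound ((Q / e) ^+ 2).
apply: le_trans (main m) _; apply: leeD2l; rewrite lee_fin -/Q.
have s0 : 0 < Num.sqrt m.+1%:R :> R by rewrite sqrtr_gt0.
rewrite ler_pdivrMr// mulrC -ler_pdivrMr//.
have : (Q / e) ^+ 2 <= m.+1%:R.
  have := archi_boundP (sqr_ge0 (Q / e)); rewrite -/m => /ltW/le_trans; apply.
  by rewrite ler_nat.
by move/ler_wsqrtr; rewrite sqrtr_sqr ger0_norm// divr_ge0// ltW.
Qed.

End slepian.

(** * Independent normal entries *)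

Section restricted_law.
Context d d' (T : measurableType d) (T' : measurableType d') (R : realType).
Variables (P : probability T R) (D : set T) (f : T -> T').
Hypotheses (mD : measurable D) (mf : measurable_fun setT f).

(** The law of [f] on the event [D], without normalisation. The two proofs are arguments so that the
    measure structure can be attached to the term. *)
Definition rlaw of measurable D & measurable_fun setT f : set T' -> \bar R :=
  fun A => P (D `&` f @^-1` A).

Local Notation law := (rlaw mD mf).

Let mpre A : measurable A -> measurable (D `&` f @^-1` A).
Proof. by move=> mA; apply: measurableI => //; rewrite -[_ @^-1` _]setTI; exact: mf. Qed.

Let law0 : law set0 = 0%E.
Proof. by rewrite /rlaw preimage_set0 setI0 measure0. Qed.

Let law_ge0 A : (0 <= law A)%E.
Proof. exact: measure_ge0. Qed.

Let law_sigma_additive : semi_sigma_additive law.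
Proof.
move=> F mF tF mUF; rewrite /rlaw preimage_bigcup setI_bigcupr.
apply: measure_semi_sigma_additive.
- by move=> n; exact: mpre.
- apply/trivIsetP => /= i j _ _ ij; rewrite setIACA setIid -preimage_setI.
  by move/trivIsetP : tF => ->//; rewrite preimage_set0 setI0.
- by rewrite -setI_bigcupr -preimage_bigcup; exact: mpre.
Qed.

HB.instance Definition _ := isMeasure.Build _ _ _ law law0 law_ge0 law_sigma_additive.

Let law_fin : fin_num_fun law.
Proof. by move=> A mA; apply: fin_num_measure; exact: mpre. Qed.

HB.instance Definition _ := Measure_isFinite.Build _ _ _ law law_fin.

End restricted_law.

Section independent_walk.
Context d (T : measurableType d) (R : realType) (P : probability T R).
Variables (p : nat) (I : eqType) (xi : I -> T -> R) (a : I -> 'I_p -> R).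
Hypothesis mxi : forall e, measurable_fun setT (xi e).
Local Notation V := (p.-tuple R).
Local Notation gamma := (normal_prob (0 : R) 1).

Definition walk (es : seq I) (x : V) (t : T) : V :=
  foldr (fun e y => shift (a e) (xi e t) y) x es.

(** For [D = setT] these are independent standard normal variables. A general event [D], independent
    of them, lets an induction absorb one variable after another into [D]. *)
Definition indep_normal (D : set T) (es : seq I) := forall B : I -> set R,
  (forall e, measurable (B e)) ->
  P (D `&` [set t | forall e, e \in es -> B e (xi e t)]) =
  (P D * \prod_(e <- es) gamma (B e))%E.

Lemma measurable_walk es x : measurable_fun setT (walk es x).
Proof.
elim: es => [|e es IH]; first exact: measurable_cst.
exact: (measurableT_comp (measurable_shift (a e)) (measurable_fun_pair IH (mxi e))).
Qed.

Lemma shift_walk b c es x t : shift b c (walk es x t) = walk es (shift b c x) t.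
Proof. by elim: es => //= e es <-; rewrite shiftC. Qed.

Lemma measurable_xi_preimage e (A : set R) :
  measurable A -> measurable (xi e @^-1` A).
Proof. by move=> mA; rewrite -[_ @^-1` _]setTI; exact: mxi. Qed.

Lemma gamma_setT : gamma setT = 1%E.
Proof. exact: (probability_setT gamma). Qed.

Lemma indep_normal_cons D e es (A : set R) (B : I -> set R) : e \notin es ->
  indep_normal D (e :: es) -> measurable A -> (forall e, measurable (B e)) ->
  P (D `&` xi e @^-1` A `&` [set t | forall e, e \in es -> B e (xi e t)]) =
  (P D * gamma A * \prod_(e <- es) gamma (B e))%E.
Proof.
move=> ees indD mA mB.
pose B' e' := if e' == e then A else B e'.
have mB' e' : measurable (B' e') by rewrite /B'; case: ifP.
have B'E e' : e' \in es -> B' e' = B e'.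
  by rewrite /B'; case: eqP => // ->; rewrite (negPf ees).
rewrite -muleA (_ : gamma A * _ = \prod_(e' <- e :: es) gamma (B' e'))%E.
  rewrite -indD//; congr (P _); rewrite -setIA; congr (_ `&` _).
  apply/seteqP; split => t /=.
    move=> [At Bt] e'; rewrite inE => /orP[/eqP ->|e'es].
      by rewrite /B' eqxx.
    by rewrite B'E//; exact: Bt.
  move=> Bt; split; first by have := Bt e (mem_head _ _); rewrite /B' eqxx.
  by move=> e' e'es; rewrite -B'E//; apply: Bt; rewrite inE e'es orbT.
rewrite big_cons {1}/B' eqxx; congr (_ * _)%E.
by apply: eq_big_seq => e' e'es; rewrite B'E.
Qed.

Lemma indep_normal_tail D e es (A : set R) : e \notin es ->
  indep_normal D (e :: es) -> measurable A ->
  P (D `&` xi e @^-1` A) = (P D * gamma A)%E /\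
  indep_normal (D `&` xi e @^-1` A) es.
Proof.
move=> ees indD mA.
have PDA : P (D `&` xi e @^-1` A) = (P D * gamma A)%E.
  have := indep_normal_cons ees indD mA (fun=> measurableT).
  rewrite big1 ?mule1; last by move=> e' _; exact: gamma_setT.
  by move=> <-; congr (P _); apply/seteqP; split => t //= [].
split => // B mB; rewrite PDA; exact: indep_normal_cons.
Qed.

Local Notation indicator C := (fun y : V => (\1_C y)%:E : \bar R).

(** On [D], the joint law of [xi e] and the remaining walk is a product measure: on a rectangle
    [A * B] the induction hypothesis is applied once to [D] and once to [D] cut by [xi e] in [A].
    Integrating over sections then gives one [gstep]. *)
Lemma prob_walk es D (C : set V) x : uniq es -> measurable D ->
  indep_normal D es -> measurable C ->
  P (D `&` walk es x @^-1` C) = (P D * gmean (map a es) (indicator C) x)%E.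
Proof.
move=> + mD; elim: es D mD C x => [|e es IH] D mD C x.
  move=> _ _ mC; rewrite /= indicE; have [xC|xC] := boolP (x \in C).
    rewrite mule1; congr (P _); apply/seteqP; split => t /=; first by case.
    by move=> Dt; split => //; rewrite inE in xC.
  rewrite mule0 -(measure0 P); congr (P _); apply/seteqP; split => t //=.
  by move=> [_ Cx]; move: xC; rewrite notin_setE.
move=> /= /andP[ees ues] indD mC.
have mw := measurable_walk es x.
have mh : @measurable_fun _ _ T (measurableTypeR R * V)%type setT
    (fun t => (xi e t, walk es x t)).
  by apply: measurable_fun_pair; [exact: (mxi e)|exact: mw].
have indT : indep_normal D es.
  by have [_] := indep_normal_tail ees indD measurableT; rewrite preimage_setT setIT.
have rect (A : set (measurableTypeR R)) (B : set V) :
    measurable A -> measurable B ->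
    rlaw P mD mh (A `*` B) = (gamma A * rlaw P mD mw B)%E.
  move=> mA mB; rewrite /rlaw.
  have [PDA indDA] := indep_normal_tail ees indD mA.
  have -> : D `&` (fun t => (xi e t, walk es x t)) @^-1` (A `*` B) =
      (D `&` xi e @^-1` A) `&` walk es x @^-1` B.
    by rewrite -setIA.
  rewrite IH//; last by apply: measurableI => //; exact: measurable_xi_preimage.
  by rewrite PDA IH// -muleA muleCA.
pose X : set (measurableTypeR R * V) := [set z | C (shift (a e) z.1 z.2)].
have mX : measurable X.
  rewrite -[X]setTI; apply: (measurableT_comp (f := fun z : V * R => shift (a e) z.2 z.1)
    (g := fun z : measurableTypeR R * V => (z.2, z.1))) => //; first exact: measurable_shift.
  exact: measurable_fun_pair.
have XE := product_measure_unique (m1 := gamma) (m2 := rlaw P mD mw)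
  (m' := rlaw P mD mh) rect mX.
rewrite -[LHS]/(rlaw P mD mh X) -XE.
rewrite -[LHS]/(\int[gamma]_c rlaw P mD mw (xsection X c))%E.
have mC1 : measurable_fun setT (indicator C).
  by apply/measurable_EFinP; exact: measurable_indic.
have C10 y : (0 <= indicator C y)%E by rewrite lee_fin.
rewrite /= /gstep -(ge0_integralZl gamma measurableT); last 3 first.
- by apply: measurable_shift1; exact: measurable_gmean.
- by move=> c _; exact: gmean_ge0.
- exact: measure_ge0.
apply: eq_integral => c _; rewrite -IH//.
congr (P (_ `&` _)); apply/seteqP; split => t /=;
  by rewrite /xsection/= inE /X/= shift_walk.
Qed.

Lemma integral_rlawT d' (T' : measurableType d') (f : T -> T')
    (mf : measurable_fun setT f) (h : T' -> \bar R) :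
  measurable_fun setT h -> (forall y, 0 <= h y)%E ->
  (\int[rlaw P measurableT mf]_y h y = \int[P]_t h (f t))%E.
Proof.
move=> mh h0; transitivity (\int[pushforward P f]_y h y)%E.
  apply: eq_measure_integral => // A mA _.
  exact: (congr1 P (setTI (f @^-1` A))).
by rewrite (ge0_integral_pushforward mf).
Qed.

Lemma integral_walk es (F : V -> \bar R) x : uniq es ->
  indep_normal setT es -> measurable_fun setT F -> (forall y, 0 <= F y)%E ->
  (\int[P]_t F (walk es x t) = gmean (map a es) F x)%E.
Proof.
move=> + + mF F0; elim: es x => [|e es IH] x.
  move=> _ _; rewrite /= integral_cst//.
  by rewrite [X in (_ * X)%E](probability_setT P) mule1.
move=> /= /andP[ees ues] indD.
have mw := measurable_walk es x.
have mh : @measurable_fun _ _ T (measurableTypeR R * V)%type setT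
    (fun t => (xi e t, walk es x t)).
  by apply: measurable_fun_pair; [exact: (mxi e)|exact: mw].
have indT : indep_normal setT es.
  by have [_] := indep_normal_tail ees indD measurableT; rewrite preimage_setT setIT.
have rect (A : set (measurableTypeR R)) (B : set V) :
    measurable A -> measurable B ->
    rlaw P measurableT mh (A `*` B) = (gamma A * rlaw P measurableT mw B)%E.
  move=> mA mB; rewrite /rlaw.
  have [PDA indDA] := indep_normal_tail ees indD mA.
  have -> : setT `&` (fun t => (xi e t, walk es x t)) @^-1` (A `*` B) =
      (setT `&` xi e @^-1` A) `&` walk es x @^-1` B.
    by rewrite -setIA.
  rewrite prob_walk//; last by apply: measurableI => //; exact: measurable_xi_preimage.
  by rewrite PDA prob_walk// -muleA muleCA.
pose Phi (z : measurableTypeR R * V) := F (shift (a e) z.1 z.2).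
have mPhi : measurable_fun setT Phi.
  apply: (measurableT_comp mF).
  apply: (measurableT_comp (measurable_shift (a e)) (g := fun z : measurableTypeR R * V => (z.2, z.1))).
  exact: measurable_fun_pair.
transitivity (\int[rlaw P measurableT mh]_z Phi z)%E.
  by rewrite integral_rlawT// => z; exact: F0.
transitivity (\int[(gamma \x rlaw P measurableT mw)%E]_z Phi z)%E.
  apply: eq_measure_integral => X mX _; apply/esym.
  apply: (product_measure_unique (m1 := gamma) (m2 := rlaw P measurableT mw)
    (m' := rlaw P measurableT mh)) => // A B mA mB; exact: rect.
rewrite (fubini_tonelli1 (m1 := gamma) (m2 := rlaw P measurableT mw) Phi mPhi);
  last by move=> z; exact: F0.
apply: eq_integral => c _.
rewrite /fubini_F integral_rlawT; last 2 first.
- apply: (measurableT_comp mPhi (g := fun y : V => (c : measurableTypeR R, y))).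
  exact: pair1_measurable.
- by move=> y; exact: F0.
under eq_integral do rewrite /Phi/= shift_walk.
exact: IH.
Qed.

End independent_walk.

(** * Linear algebra *)

Section linear_algebra.
Variable R : realType.

Definition dotr n (v w : 'rV[R]_n) : R := \sum_j v 0 j * w 0 j.

Lemma mulmx_trE n (v w : 'rV[R]_n) : (v *m w^T) 0 0 = dotr v w.
Proof. by rewrite !mxE; apply: eq_bigr => j _; rewrite !mxE. Qed.

Lemma dotr_ge0 n (v : 'rV[R]_n) : 0 <= dotr v v.
Proof. by apply: sumr_ge0 => j _; rewrite -expr2 sqr_ge0. Qed.

Lemma dotr_eq0 n (v : 'rV[R]_n) : dotr v v = 0 -> v = 0.
Proof.
move=> /eqP; rewrite psumr_eq0; last by move=> j _; rewrite -expr2 sqr_ge0.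
move=> /allP vj; apply/rowP => j; rewrite mxE; apply/eqP.
by have := vj j (mem_index_enum _); rewrite /= mulf_eq0 orbb.
Qed.

(** The hypotheses say that [Q = B'^T B'] is an orthogonal projection whose range contains the rows
    of [A']. The normalised residual of [a] is added as a row; these identities, unlike
    orthonormality, also hold with zero rows. *)
Lemma gram_schmidt_step m n (a : 'rV[R]_n) (A' B' : 'M[R]_(m, n)) :
  A' *m (B'^T *m B') = A' -> B' *m (B'^T *m B') = B' ->
  exists B : 'M[R]_(1 + m, n),
    col_mx a A' *m (B^T *m B) = col_mx a A' /\ B *m (B^T *m B) = B.
Proof.
move=> A'Q B'Q; set Q := B'^T *m B' in A'Q B'Q.
have QT : Q^T = Q by rewrite trmx_mul trmxK.
have QQ : Q *m Q = Q by rewrite {1}/Q -mulmxA B'Q.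
pose v := a - a *m Q.
have vQ : v *m Q = 0 by rewrite mulmxBl -mulmxA QQ subrr.
have QvT : Q *m v^T = 0 by rewrite -[Q]QT -trmx_mul vQ trmx0.
have vvT : a *m v^T = v *m v^T.
  by rewrite mulmxBl -[a *m Q *m _]mulmxA QvT mulmx0 subr0.
have A'v : A' *m v^T = 0 by rewrite -A'Q -mulmxA QvT mulmx0.
have B'v : B' *m v^T = 0 by rewrite -B'Q -mulmxA QvT mulmx0.
have aE : v + a *m Q = a by rewrite subrK.
(* If [v = 0], then [s = 0^-1 = 0] and the new row is zero. *)
clearbody v; pose s := (Num.sqrt (dotr v v))^-1; pose e := s *: v.
have eTe : e^T *m e = (s ^+ 2) *: (v^T *m v).
  by rewrite /e [(s *: v)^T]linearZ/= -scalemxAl -scalemxAr scalerA expr2.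
have vv : (s ^+ 2) *: (v *m v^T *m v) = v.
  have -> : v *m v^T = (dotr v v)%:M by rewrite [LHS]mx11_scalar mulmx_trE.
  rewrite mul_scalar_mx scalerA /s exprVn sqr_sqrtr ?dotr_ge0//.
  have [v0|v0] := eqVneq (dotr v v) 0; last by rewrite mulVf ?scale1r.
  by rewrite (dotr_eq0 v0) scaler0.
exists (col_mx e B').
have BB : (col_mx e B')^T *m (col_mx e B') = (s ^+ 2) *: (v^T *m v) + Q.
  by rewrite tr_col_mx mul_row_col eTe.
rewrite BB !mul_col_mx !mulmxDr -!scalemxAr.
split; congr col_mx.
- by rewrite (mulmxA a v^T) vvT vv aE.
- by rewrite (mulmxA A' v^T) A'v mul0mx scaler0 add0r.
- by rewrite -!scalemxAl (mulmxA v v^T) scalerA mulrC -scalerA vv vQ scaler0 addr0.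
- by rewrite (mulmxA B' v^T) B'v mul0mx scaler0 add0r.
Qed.

(* The rows of [A] may be dependent: some rows of [B] are then zero. *)
Lemma gram_schmidt m n (A : 'M[R]_(m, n)) : exists B : 'M[R]_(m, n),
  A *m (B^T *m B) = A /\ B *m (B^T *m B) = B.
Proof.
elim: m A => [|m IH] A; first by exists A; split; apply/matrixP => -[].
have [B' [A'Q B'Q]] := IH (dsubmx (A : 'M[R]_(1 + m, n))).
have := gram_schmidt_step (usubmx (A : 'M[R]_(1 + m, n))) A'Q B'Q.
by rewrite vsubmxK.
Qed.

(** Realises the covariance [<u,w>] on [V] with only [\dim V] coordinates; this is how [k] enters
    the bound. *)
Lemma parseval_frame n (V : {vspace 'rV[R]_n}) :
  exists B : 'M[R]_(\dim V, n), forall u w : 'rV[R]_n, u \in V ->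
  dotr u w = \sum_j (u *m B^T) 0 j * (w *m B^T) 0 j.
Proof.
pose A : 'M[R]_(\dim V, n) := \matrix_(j < \dim V) (vbasis V)`_j.
have [B [AQ _]] := gram_schmidt A; exists B => u w uV.
have uA : u = (\row_j coord (vbasis V) j u) *m A.
  rewrite [LHS](coord_vbasis uV) mulmx_sum_row; apply: eq_bigr => j _.
  by rewrite mxE rowK.
have uQ : u *m (B^T *m B) = u by rewrite uA -mulmxA AQ.
rewrite -[LHS]mulmx_trE -{1}uQ -[u *m B^T]/(u *m B^T).
have -> : u *m (B^T *m B) *m w^T = (u *m B^T) *m (w *m B^T)^T.
  by rewrite trmx_mul trmxK !mulmxA.
by rewrite mulmx_trE.
Qed.

(* One point of the sphere is chosen in each cell of a grid on the cube [-1, 1]^n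
   that meets it. *)
Lemma sphere_net n (V : {vspace 'rV[R]_n}) (delta : R) :
  0 < delta -> (0 < \dim V)%N ->
  exists p (u : 'I_p -> 'rV[R]_n), [/\ (0 < p)%N,
    forall i, u i \in V /\ dotr (u i) (u i) = 1 &
    forall w, w \in V -> dotr w w = 1 ->
      exists i, forall j, `|w 0 j - u i 0 j| <= delta].
Proof.
move=> d0 dV.
pose S (w : 'rV[R]_n) := w \in V /\ dotr w w = 1.
have [u0 Su0] : exists u0, S u0.
  have v0 : vpick V != 0 by rewrite vpick0 -dimv_eq0 -lt0n.
  have vv0 : 0 < dotr (vpick V) (vpick V).
    rewrite lt_neqAle dotr_ge0 andbT eq_sym; apply: contra v0 => /eqP.
    by move=> /dotr_eq0 ->.
  pose s := (Num.sqrt (dotr (vpick V) (vpick V)))^-1.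
  exists (s *: vpick V); split; first by rewrite rpredZ ?memv_pick.
  transitivity (s ^+ 2 * dotr (vpick V) (vpick V)).
    by rewrite /dotr mulr_sumr; apply: eq_bigr => j _; rewrite !mxE; ring.
  by rewrite exprVn sqr_sqrtr ?(ltW vv0)// mulVf// gt_eqF.
pose M := (Num.bound delta^-1).
have Md : 1 <= M%:R * delta.
  rewrite -ler_pdivrMr// mul1r; apply/ltW/archi_boundP.
  by rewrite invr_ge0 ltW.
have M0 : 0 < M%:R :> R by rewrite -(pmulr_lgt0 _ d0) (lt_le_trans ltr01).
(* Index of the grid cell of side [1 / M <= delta]. A coordinate equal to 1 gives the index [2 M],
   hence [2 M + 1] values. *)
pose key (w : 'rV[R]_n) : {ffun 'I_n -> 'I_(2 * M).+1} :=
  [ffun j => inord (Num.truncn ((w 0 j + 1) * M%:R))].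
have S1 w j : S w -> `|w 0 j| <= 1.
  move=> [_ w1]; rewrite -(expr_le1 (n := 2))// real_normK ?num_real// -w1.
  rewrite /dotr (bigD1 j)//= -expr2 lerDl sumr_ge0// => i _.
  by rewrite -expr2 sqr_ge0.
have keyE w j : S w -> key w j = Num.truncn ((w 0 j + 1) * M%:R) :> nat.
  move=> Sw; rewrite ffunE inordK// ltnS.
  have := S1 w j Sw; rewrite ler_norml => /andP[w_ge w_le].
  have tl : (Num.truncn ((w 0 j + 1) * M%:R))%:R <= (w 0 j + 1) * M%:R.
    by rewrite truncn_le mulr_ge0 ?(ltW M0)//; lra.
  rewrite -(ler_nat R) (le_trans tl)//.
  by rewrite natrM ler_wpM2r ?(ltW M0)//; lra.
(* Cells that miss the sphere receive the default point [u0], so every index yields a unit vector of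
   [V]. *)
pose rep k := if pselect (exists w, S w /\ key w = k) is left H
  then sval (cid H) else u0.
have Srep k : S (rep k).
  by rewrite /rep; case: pselect => // H; case: (cid H) => ? [].
have keyrep w : S w -> key (rep (key w)) = key w.
  move=> Sw; rewrite /rep; case: pselect => [H|[]]; last by exists w.
  by case: (cid H) => ? [].
exists #|{ffun 'I_n -> 'I_(2 * M).+1}|, (fun i => rep (enum_val i)); split.
- by apply/card_gt0P; exists (key u0).
- by move=> i; exact: Srep.
- move=> w wV w1; have Sw : S w by split.
  exists (enum_rank (key w)) => j; rewrite enum_rankK.
  have SR := Srep (key w).
  have := congr1 (fun f : {ffun _ -> _} => val (f j)) (keyrep w Sw).
  rewrite /= !keyE// => E.
  have ge0 w' : S w' -> 0 <= (w' 0 j + 1) * M%:R.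
    move=> Sw'; have := S1 w' j Sw'; rewrite ler_norml => /andP[? ?].
    by rewrite mulr_ge0 ?(ltW M0)//; lra.
  have /andP[wl wr] := truncn_itv (ge0 _ Sw).
  have /andP[rl rr] := truncn_itv (ge0 _ SR).
  rewrite E in rl rr.
  set N := (Num.truncn _) in wl wr rl rr.
  rewrite -natr1 in wr rr.
  rewrite -(ler_pM2l M0) (le_trans _ Md)// -[M%:R]gtr0_norm// -normrM.
  rewrite ler_norml; apply/andP; split; lra.
Qed.

Lemma qformE n (X : 'M[R]_n) v : qform X v = \sum_i \sum_j X i j * (v 0 i * v 0 j).
Proof.
rewrite /qform -mulmxA mxE; apply: eq_bigr => i _; rewrite mxE mulr_sumr.
by apply: eq_bigr => j _; rewrite !mxE; ring.
Qed.

(** Reduces to unit vectors by homogeneity; there [|w_j w_k - u_j u_k| <= 2 delta], as coordinates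
    are at most 1 in absolute value. *)
Lemma qform_net n (V : {vspace 'rV[R]_n}) (delta lam : R) p (u : 'I_p -> 'rV[R]_n)
    (X : 'M[R]_n) v :
  0 <= delta ->
  (forall i, dotr (u i) (u i) = 1) ->
  (forall w, w \in V -> dotr w w = 1 ->
      exists i, forall j, `|w 0 j - u i 0 j| <= delta) ->
  (forall i, qform X (u i) <= lam) -> v \in V ->
  qform X v <= (lam + 2 * delta * \sum_i \sum_j `|X i j|) * dotr v v.
Proof.
move=> d0 u1 net ulam vV.
have le1 (w : 'rV[R]_n) j : dotr w w = 1 -> `|w 0 j| <= 1.
  move=> w1; rewrite -(expr_le1 (n := 2))// real_normK ?num_real// -w1.
  rewrite /dotr (bigD1 j)//= -expr2 lerDl sumr_ge0// => i _.
  by rewrite -expr2 sqr_ge0.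
have [v0|v0] := eqVneq (dotr v v) 0.
  rewrite v0 mulr0 (dotr_eq0 v0) qformE big1// => i _; rewrite big1// => j _.
  by rewrite !mxE !mulr0.
have vv0 : 0 < dotr v v by rewrite lt_neqAle eq_sym v0 dotr_ge0.
pose s := Num.sqrt (dotr v v); have s0 : 0 < s by rewrite sqrtr_gt0.
have sE : s ^+ 2 = dotr v v by rewrite sqr_sqrtr// ltW.
pose w := s^-1 *: v.
have w1 : dotr w w = 1.
  transitivity (s^-1 ^+ 2 * dotr v v); last by rewrite -sE exprVn mulVf// expf_neq0// gt_eqF.
  by rewrite /dotr mulr_sumr; apply: eq_bigr => j _; rewrite !mxE; ring.
have -> : qform X v = qform X w * dotr v v.
  rewrite -sE !qformE mulr_suml; apply: eq_bigr => i _; rewrite mulr_suml.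
  by apply: eq_bigr => j _; rewrite !mxE; field; rewrite gt_eqF.
rewrite ler_wpM2r ?(ltW vv0)//.
have [i wi] := net w (memvZ _ vV) w1.
rewrite -lerBlDl; apply: le_trans (_ : qform X w - qform X (u i) <= _); first by rewrite lerD2l lerN2.
rewrite !qformE -sumrB mulr_sumr; apply: ler_sum => j _.
rewrite -sumrB mulr_sumr; apply: ler_sum => k _.
rewrite -mulrBr (le_trans (ler_norm _))// normrM mulrC ler_wpM2r//.
have -> : w 0 j * w 0 k - u i 0 j * u i 0 k =
  (w 0 j - u i 0 j) * w 0 k + u i 0 j * (w 0 k - u i 0 k) by ring.
rewrite (le_trans (ler_normD _ _))// !normrM mulr2n mulrDl mul1r lerD//.
  by rewrite -[leRHS]mulr1 ler_pM// le1.
by rewrite -[leRHS]mul1r ler_pM// le1.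
Qed.

(* [lam I - G] lies in the cone, so its pairing with the dual cone is nonnegative. *)
Lemma trip_BH_le n N (V : 'I_N -> {vspace 'rV[R]_n}) (G X : 'M[R]_n) (lam : R) :
  symmx G ->
  (forall i v, v \in V i -> qform G v <= lam * dotr v v) ->
  BH (dual_cone (kpsd_cone V)) X -> trip G X <= lam - n%:R^-1 * \tr G.
Proof.
move=> symG Glam [Y [[symY dualY] trY] <-].
have : 0 <= trip (lam%:M - G) Y.
  apply: dualY; split; first by rewrite /symmx linearB/= tr_scalar_mx symG.
  move=> i v /Glam; rewrite -subr_ge0; congr (0 <= _).
  apply/esym; rewrite /qform mulmxBr mulmxBl mul_mx_scalar -scalemxAl mxE.
  by rewrite [X in X + _]mxE (mulmx_trE v v) [X in _ + X]mxE.
rewrite /trip mulmxBl linearB/= mul_scalar_mx linearZ/= trY mulr1 subr_ge0.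
by rewrite mulmxBr linearB/= -scalemxAr mulmx1 linearZ/= lerD2r.
Qed.

End linear_algebra.

(** * Moment generating function of the chi distribution *)

Section chi_bound.
Variables (R : realType) (p : nat).
Local Notation V := (p.-tuple R).
Implicit Types (l : seq ('I_p -> R)) (x z : V).

(** The point reached from [x] when the normal coefficients integrated out by [gmean l] take the
    values [s]. *)
Fixpoint moves l (s : seq R) x : V :=
  match l, s with
  | a :: l', c :: s' => moves l' s' (shift a c x)
  | _, _ => x
  end.

(* AM-GM: [c a <= c^2 / q + q a^2 / 4] for each pair of coordinates *)
Lemma moves_le l s x u (q : R) : 0 < q -> size s = size l ->
  tnth (moves l s x) u <=
  tnth x u + (\sum_(c <- s) c ^+ 2) / q + (\sum_(a <- l) a u ^+ 2) * q / 4.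
Proof.
move=> q0; elim: l s x => [|a l IH] [|c s] x //=.
  by rewrite !big_nil !mul0r !addr0.
move=> [ss]; rewrite (le_trans (IH _ _ ss))// tnth_mktuple !big_cons.
have : c * a u <= c ^+ 2 / q + a u ^+ 2 * q / 4.
  rewrite -subr_ge0.
  have -> : c ^+ 2 / q + a u ^+ 2 * q / 4 - c * a u = q^-1 * (c - q * a u / 2) ^+ 2.
    by field; rewrite gt_eqF.
  by rewrite mulr_ge0 ?sqr_ge0// invr_ge0 ltW.
rewrite !mulrDl; lra.
Qed.

(** The dominating function is a product over the coefficients, each contributing one integral
    [(1 - th)^(-1/2)]. In the induction [c] absorbs the factors of the coefficients already
    fixed. *)
Lemma gmean_le_gauss l F x (c th : R) : th < 1 -> 0 <= c ->
  measurable_fun setT F -> (forall y, 0 <= F y)%E ->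
  (forall s, size s = size l ->
    (F (moves l s x) <= (c * expR (th * (\sum_(t <- s) t ^+ 2) / 2))%:E)%E) ->
  (gmean l F x <= (c * (Num.sqrt (1 - th))^-1 ^+ size l)%:E)%E.
Proof.
move=> th1 c0 mF F0; elim: l c x c0 => [|a l IH] c x c0 H.
  by have := H [::] erefl; rewrite /= big_nil mulr0 mul0r expR0.
have mE : measurable_fun [set: R] (fun t : R => (expR (th * t ^+ 2 / 2))%:E).
  apply/measurable_EFinP/measurableT_comp => //; apply: measurable_funM => //.
  by apply: measurable_funM => //; exact: measurable_funX.
pose K := c * (Num.sqrt (1 - th))^-1 ^+ size l.
have K0 : 0 <= K by rewrite mulr_ge0// exprn_ge0// invr_ge0 sqrtr_ge0.
apply: (@le_trans _ _ (\int[normal_prob (0 : R) 1]_t (K%:E * (expR (th * t ^+ 2 / 2))%:E))%E).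
  apply: ge0_le_integral => //.
  - by move=> t _; exact: gmean_ge0.
  - by apply: measurable_shift1; exact: measurable_gmean.
  - exact: measurable_funeM.
  - move=> t _; rewrite -EFinM /K mulrAC; apply: IH.
      by rewrite mulr_ge0 ?expR_ge0.
    move=> s ss; rewrite (le_trans (H (t :: s) _))//=; first by rewrite ss.
    by rewrite big_cons mulrDr mulrDl expRD mulrA.
rewrite ge0_integralZl//.
by rewrite integral_normal_expR_sqr// -EFinM exprSr mulrA.
Qed.

Lemma softmax_le (alpha beta M : R) z : (0 < p)%N -> 0 < alpha -> 0 < beta ->
  (forall u, tnth z u <= M) ->
  (softmax alpha beta z <= (p%:R `^ alpha * expR (alpha * beta * M))%:E)%E.
Proof.
move=> p_gt0 a0 b0 zM; rewrite lee_fin.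
have -> : p%:R `^ alpha * expR (alpha * beta * M) = (p%:R * expR (beta * M)) `^ alpha.
  by rewrite powRM ?expR_ge0// -expRM; congr (_ * expR _); ring.
apply: ge0_ler_powR; rewrite ?nnegrE ?(ltW a0) ?mulr_ge0 ?expR_ge0//.
  by apply/ltW/expsum_gt0.
rewrite mulr_natl -[X in _ *+ X]card_ord -sumr_const.
by apply: ler_sum => u _; rewrite ler_expR ler_wpM2l// ltW.
Qed.

(* With [q = t + sqrt (t^2 + 2 k)] one has [1 - 2 t / q = 2 k / q^2], so the
   Gaussian integrals contribute [(q / sqrt (2 k))^k], which is then bounded
   using [y <= exp (y - 1)]. *)
Lemma chi_exponent (k : nat) (t : R) : (0 < k)%N -> 0 < t ->
  exists q : R, [/\ 0 < q, 2 * t / q < 1 &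
    expR (t * q / 2) * (Num.sqrt (1 - 2 * t / q))^-1 ^+ k <=
    expR (t * Num.sqrt (2 * k%:R) + t ^+ 2)].
Proof.
move=> k0 t0; set kap := Num.sqrt (2 * k%:R).
have k2 : 0 < 2 * k%:R :> R by rewrite mulr_gt0// ltr0n.
have kap0 : 0 < kap by rewrite sqrtr_gt0.
have kapE : kap ^+ 2 = 2 * k%:R by rewrite sqr_sqrtr// ltW.
pose D := Num.sqrt (t ^+ 2 + kap ^+ 2).
have DE : D ^+ 2 = t ^+ 2 + kap ^+ 2 by rewrite sqr_sqrtr// addr_ge0// sqr_ge0.
have D0 : 0 <= D by exact: sqrtr_ge0.
pose q := t + D; have q0 : 0 < q by rewrite ltr_wpDr.
have qE : q ^+ 2 - 2 * t * q = kap ^+ 2 by rewrite /q; ring: DE.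
have thE : 1 - 2 * t / q = (kap / q) ^+ 2.
  by rewrite exprMn exprVn -qE; field; rewrite gt_eqF.
exists q; split => //.
  by rewrite -subr_gt0 thE exprn_gt0// divr_gt0.
rewrite thE sqrtr_sqr gtr0_norm ?divr_gt0// invf_div.
have yle : (q / kap) ^+ k <= expR ((q / kap - 1) * k%:R).
  rewrite expRM_natr; apply: lerXn2r.
  - by rewrite nnegrE divr_ge0// ltW.
  - by rewrite nnegrE expR_ge0.
  - by rewrite (le_trans _ (expR_ge1Dx _))// addrC subrK.
apply: (@le_trans _ _ (expR (t * q / 2) * expR ((q / kap - 1) * k%:R))).
  by rewrite ler_wpM2l ?expR_ge0.
rewrite -expRD ler_expR -subr_ge0.
(* Expressed through [q] and [kap] alone, the gap between the exponents is a perfect square. *)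
have kE : k%:R = kap ^+ 2 / 2 by rewrite kapE; field.
have tE : t = (q ^+ 2 - kap ^+ 2) / (2 * q).
  by rewrite -qE; field; rewrite gt_eqF.
rewrite kE tE.
have -> : (q ^+ 2 - kap ^+ 2) / (2 * q) * kap + ((q ^+ 2 - kap ^+ 2) / (2 * q)) ^+ 2 -
  ((q ^+ 2 - kap ^+ 2) / (2 * q) * q / 2 + (q / kap - 1) * (kap ^+ 2 / 2)) =
  (kap / q * (q - kap) / 2) ^+ 2.
  by field; rewrite !gt_eqF.
exact: sqr_ge0.
Qed.

(** By [moves_le] and the variance bound 2, all coordinates are at most [|s|^2 / q + q / 2]. With
    [t = alpha beta] and [th = 2 t / q], the exponent [t |s|^2 / q] is [th |s|^2 / 2], as
    [gmean_le_gauss] asks. *)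
Lemma gmean_softmax_le l (alpha beta : R) : (0 < p)%N -> (0 < size l)%N ->
  0 < alpha -> 0 < beta -> (forall u, \sum_(a <- l) a u ^+ 2 <= 2) ->
  (gmean l (softmax alpha beta) [tuple 0%R | _ < p] <=
   (p%:R `^ alpha * expR (alpha * beta * Num.sqrt (2 * (size l)%:R)
      + (alpha * beta) ^+ 2))%:E)%E.
Proof.
move=> p0 l0 a0 b0 lle; have t0 : 0 < alpha * beta by rewrite mulr_gt0.
have [q [q0 th1 qle]] := chi_exponent l0 t0.
set t := alpha * beta in t0 th1 qle *.
have P0 : 0 <= p%:R `^ alpha :> R by exact: powR_ge0.
apply: (@le_trans _ _ (p%:R `^ alpha * expR (t * q / 2) *
   (Num.sqrt (1 - 2 * t / q))^-1 ^+ size l)%:E).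
  apply: gmean_le_gauss; [exact: th1|by rewrite mulr_ge0 ?expR_ge0|
    exact: measurable_softmax|by move=> y; exact: softmax_ge0|].
  move=> s ss.
  apply: le_trans (softmax_le (M := (\sum_(c <- s) c ^+ 2) / q + q / 2) p0 a0 b0 _) _.
    move=> u; rewrite (le_trans (moves_le _ u q0 ss))// tnth_mktuple add0r lerD2l.
    have := ler_wpM2r (ltW q0) (lle u); lra.
  rewrite lee_fin -[leRHS]mulrA ler_wpM2l// -expRD ler_expR -/t.
  rewrite le_eqVlt; apply/orP; left; apply/eqP.
  by field; rewrite gt_eqF.
by rewrite lee_fin -[leLHS]mulrA ler_wpM2l.
Qed.

End chi_bound.

(** * The Gaussian width *)

Section entries.
Variables (R : realType) (n : nat).

Definition upper_pairs : seq ('I_n * 'I_n) :=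
  [seq e : 'I_n * 'I_n <- index_enum ('I_n * 'I_n)%type | (e.1 <= e.2)%N].

(* [G_ij = pair_scale^-1 * entry], with standard normal entries, also for [i < j]
   where [G_ij] has variance 1/2. *)
Definition pair_scale (e : 'I_n * 'I_n) : R :=
  if e.1 == e.2 then 1 else Num.sqrt 2.

Lemma pair_scale_gt0 e : 0 < pair_scale e.
Proof. by rewrite /pair_scale; case: ifP => _ //; rewrite sqrtr_gt0. Qed.

Lemma upper_pairs_uniq : uniq upper_pairs.
Proof. by rewrite filter_uniq// index_enum_uniq. Qed.

(** The squared scale is the multiplicity of a pair: 1 on the diagonal, 2 off it. So the trace inner
    product is the standard one in the rescaled entries. *)
Lemma symmetric_sum (f : 'I_n -> 'I_n -> R) : (forall i j, f i j = f j i) ->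
  \sum_i \sum_j f i j = \sum_(e <- upper_pairs) pair_scale e ^+ 2 * f e.1 e.2.
Proof.
move=> fC; rewrite /upper_pairs big_filter pair_bigA/=.
rewrite (bigID (fun e : 'I_n * 'I_n => (e.1 <= e.2)%N))/=.
have -> : \sum_(e : 'I_n * 'I_n | ~~ (e.1 <= e.2)%N) f e.1 e.2 =
    \sum_(e : 'I_n * 'I_n | (e.1 <= e.2)%N) (e.1 != e.2)%:R * f e.1 e.2.
  rewrite (reindex_inj (h := fun e : 'I_n * 'I_n => (e.2, e.1)))/=; last first.
    by move=> [i j] [i' j'] /= [-> ->].
  rewrite [RHS](bigID (fun e : 'I_n * 'I_n => e.1 == e.2))/=.
  rewrite [X in _ = X + _]big1 ?add0r; last first.
    by move=> e /andP[_ ->]; rewrite mul0r.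
  apply: eq_big => [[i j]|[i j]] /=; first by rewrite -ltnNge ltn_neqAle andbC.
  by rewrite -ltnNge ltn_neqAle => /andP[ij _]; rewrite ij mul1r fC.
rewrite -big_split/=; apply: eq_bigr => e _; rewrite /pair_scale.
case: eqP => _; first by rewrite mul0r addr0 expr1n mul1r.
by rewrite sqr_sqrtr// mul1r; ring.
Qed.

(** A common shift [c] of all coordinates multiplies [softmax] by [exp (alpha beta c)]. Placed last
    in the list, it is the innermost step and acts directly on [softmax]. *)
Lemma gmean_ones p (alpha beta : R) l x : (0 < p)%N -> 0 < alpha ->
  gmean (l ++ [:: fun=> 1]) (@softmax R p alpha beta) x =
  ((expR ((alpha * beta) ^+ 2 / 2))%:E * gmean l (softmax alpha beta) x)%E.
Proof.
move=> p0 a0; rewrite /gmean foldr_cat -/(gmean l _) /=.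
have -> : gstep (fun=> 1) (@softmax R p alpha beta) =
    (fun y => (expR ((alpha * beta) ^+ 2 / 2))%:E * softmax alpha beta y)%E.
  apply/funext => y; rewrite /gstep.
  transitivity (\int[normal_prob (0 : R) 1]_c (softmax alpha beta y *
      (expR ((alpha * beta) * c))%:E))%E.
    apply: eq_integral => c _; rewrite /softmax -EFinM; congr EFin.
    have -> : expsum beta (shift (fun=> 1) c y) = expsum beta y * expR (beta * c).
      rewrite /expsum mulr_suml; apply: eq_bigr => u _.
      by rewrite tnth_mktuple -expRD; congr expR; ring.
    rewrite powRM ?expR_ge0 ?(ltW (expsum_gt0 beta p0 y))// -expRM.
    by congr (_ * expR _); ring.
  rewrite ge0_integralZl//.
  - by rewrite integral_normal_expR muleC.
  - by apply/measurable_EFinP/measurableT_comp => //; exact: measurable_funM.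
  - exact: softmax_ge0.
rewrite -[LHS]/(gmean l _ x) gmeanZ ?expR_ge0//.
  exact: measurable_softmax.
exact: softmax_ge0.
Qed.

Context d (T : measurableType d) (P : probability T R) (G : T -> 'M[R]_n).
Hypothesis stdG : std_gaussian_sym P G.

Definition entry (e : 'I_n * 'I_n) (t : T) : R := pair_scale e * G t e.1 e.2.

Lemma measurable_entry e : measurable_fun setT (entry e).
Proof. by case: stdG => _ mG _ _ _; apply: measurable_funM => //; exact: mG. Qed.

Let scaled_preimage e (B : set R) : set R := (fun y => pair_scale e * y) @^-1` B.

Let measurable_scaled_preimage e (B : set R) :
  measurable B -> measurable (scaled_preimage e B).
Proof.
move=> mB; rewrite -[scaled_preimage e B]setTI.
by apply: (measurable_funM (f := cst (pair_scale e)) (g := id)).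
Qed.

Lemma entry_law (e : 'I_n * 'I_n) (B : set R) : (e.1 <= e.2)%N -> measurable B ->
  P (entry e @^-1` B) = normal_prob 0 1 B.
Proof.
case: stdG => _ _ _ dG oG; case: e => i j /= ij mB.
have [E|ne] := eqVneq i j.
  rewrite -(dG i B mB); congr (P _); apply/seteqP; split => t /=;
    by rewrite /entry /pair_scale /= -E eqxx mul1r.
have lt_ij : (i < j)%N by rewrite ltn_neqAle ij andbT.
have mB' := measurable_scaled_preimage (i, j) mB.
rewrite -[LHS]/(P ((fun t => G t i j) @^-1` (scaled_preimage (i, j) B))).
rewrite (oG _ _ _ lt_ij mB').
have s0 : 0 < Num.sqrt (2^-1) :> R by rewrite sqrtr_gt0 invr_gt0.
have := @integral_normal_affine R 0 (Num.sqrt (2^-1))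
  (fun y => (\1_(scaled_preimage (i, j) B) y)%:E) s0.
rewrite integral_indic// setIT => ->; last 2 first.
- by apply/measurable_EFinP; exact: measurable_indic.
- by move=> x; rewrite lee_fin.
transitivity (\int[normal_prob (0 : R) 1]_x (\1_B x)%:E)%E; last first.
  by rewrite integral_indic// setIT.
apply: eq_integral => x _; congr (_%:E); rewrite !indicE; congr ((nat_of_bool _)%:R).
suff E : (scaled_preimage (i, j) B) (Num.sqrt 2^-1 * x + 0) = B x.
  by apply/idP/idP; rewrite !inE E.
rewrite /scaled_preimage/= /pair_scale/= (negPf ne) addr0 mulrA -sqrtrM//.
by rewrite divff// sqrtr1 mul1r.
Qed.

Lemma entry_indep : indep_normal P entry setT upper_pairs.
Proof.
move=> B mB; case: (stdG) => _ _ iG _ _.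
have := iG (fun i j => scaled_preimage (i, j) (B (i, j)))
  (fun i j => measurable_scaled_preimage (i, j) (mB (i, j))).
rewrite probability_setT mul1e setTI.
have -> : [set t | forall i j : 'I_n, (i <= j)%N ->
    scaled_preimage (i, j) (B (i, j)) (G t i j)] =
    [set t | forall e, e \in upper_pairs -> B e (entry e t)].
  apply/seteqP; split => t /= H.
    by move=> [i j]; rewrite mem_filter/= => /andP[ij _]; exact: H.
  by move=> i j ij; apply: (H (i, j)); rewrite mem_filter ij mem_index_enum.
move=> ->; rewrite /upper_pairs big_filter pair_big_dep/=.
apply: eq_bigr => -[i j] /= ij.
by rewrite -(@entry_law (i, j) (B (i, j)) ij (mB _)).
Qed.

Lemma integral_entry (e : 'I_n * 'I_n) (h : R -> \bar R) : (e.1 <= e.2)%N ->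
  measurable_fun setT h -> (forall y, 0 <= h y)%E ->
  (\int[P]_t h (entry e t) = \int[normal_prob 0 1]_y h y)%E.
Proof.
move=> le_e mh h0.
have me : @measurable_fun _ _ T (measurableTypeR R) setT (entry e).
  exact: measurable_entry.
rewrite -(@integral_rlawT d T R P _ (measurableTypeR R) (entry e) me h mh h0).
apply: eq_measure_integral => // A mA _.
exact: (etrans (congr1 P (setTI (entry e @^-1` A))) (entry_law le_e mA)).
Qed.

Lemma integral_entry_expR (e : 'I_n * 'I_n) (s : R) : (e.1 <= e.2)%N ->
  (\int[P]_t (expR (s * entry e t))%:E = (expR (s ^+ 2 / 2))%:E)%E.
Proof.
move=> le_e; rewrite (@integral_entry e (fun y => (expR (s * y))%:E))//.
- exact: integral_normal_expR.
- by apply/measurable_EFinP/measurableT_comp => //; exact: measurable_funM.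
Qed.

End entries.

(** * Exponential moments for one subspace *)

Section subspace_bound.
Context (R : realType) (n : nat) d (T : measurableType d) (P : probability T R).
Variable G : T -> 'M[R]_n.
Hypothesis stdG : std_gaussian_sym P G.

Lemma tnth_walk p (I : eqType) (xi : I -> T -> R) (a : I -> 'I_p -> R) es x t u :
  tnth (walk xi a es x t) u = tnth x u + \sum_(e <- es) xi e t * a e u.
Proof.
elim: es => [|e es IH]; first by rewrite big_nil addr0.
by rewrite /= tnth_mktuple -/(walk xi a es x t) IH big_cons; ring.
Qed.

(** [p^alpha] is the price for replacing a maximum over [p] points by [softmax]; [alpha] is chosen
    once the net is known. *)
Lemma powR_natr_le_expR (p : nat) (eta : R) : (0 < p)%N -> 0 < eta ->
  exists alpha : R, [/\ 0 < alpha, alpha < 1 & p%:R `^ alpha <= expR eta].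
Proof.
move=> p0 eta0; have lnp : 0 <= ln p%:R :> R by rewrite ln_ge0// ler1n.
have D0 : 0 < ln p%:R + eta + 1 :> R by lra.
exists (eta / (ln p%:R + eta + 1)); split.
- by rewrite divr_gt0.
- by rewrite ltr_pdivrMr//; lra.
- rewrite /powR pnatr_eq0 -[(p == 0)%N]negbK -lt0n p0/= ler_expR mulrAC ler_pdivrMr//.
  by rewrite ler_wpM2l ?ltW//; lra.
Qed.

(** [S] is the smooth substitute for [exp (tau M)], with [M] the maximum over the net. The last
    clause is [M <= c + (exp (tau (M - c)) - 1) / tau]; [S] does not depend on [c], so one threshold
    can serve all subspaces. *)
Lemma subspace_bound (V : {vspace 'rV[R]_n}) (tau eta delta : R) :
  (0 < \dim V)%N -> 0 < tau -> 0 < eta -> 0 < delta ->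
  exists S : T -> R, [/\ measurable_fun setT S, forall t, 0 <= S t,
    (\int[P]_t (S t)%:E <=
      (expR (eta + tau * Num.sqrt (2 * (\dim V)%:R) + tau ^+ 2 / 2))%:E)%E &
    forall t v c, v \in V -> qform (G t) v <=
      (c + (S t * expR (- (tau * c)) - 1) / tau +
        2 * delta * \sum_i \sum_j `|G t i j|) * dotr v v].
Proof.
move=> dV tau0 eta0 delta0.
have [B BE] := parseval_frame V.
have [p [u [p0 uS net]]] := sphere_net delta0 dV.
have [alpha [a0 a1 pa]] := powR_natr_le_expR p0 eta0.
pose beta := tau / alpha.
have b0 : 0 < beta by rewrite divr_gt0.
have abE : alpha * beta = tau by rewrite /beta mulrC divfK// gt_eqF.
(* Of the factor [pair_scale e ^+ 2] in [symmetric_sum], one half goes here and the other into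
   [entry]. *)
pose a (e : 'I_n * 'I_n) (k : 'I_p) : R := pair_scale R e * (u k 0 e.1 * u k 0 e.2).
pose es := upper_pairs n.
pose x0 : p.-tuple R := [tuple 0%R | _ < p].
pose X t := walk (entry G) a es x0 t.
have symG t : symmx (G t) by case: stdG.
have XE t k : tnth (X t) k = qform (G t) (u k).
  rewrite tnth_walk tnth_mktuple add0r qformE.
  rewrite (symmetric_sum (f := fun i j => G t i j * (u k 0 i * u k 0 j))).
    by apply: eq_bigr => e _; rewrite /entry /a; ring.
  by move=> i j; rewrite -{1}(symG t) mxE; ring.
have mX : measurable_fun setT X.
  by apply: measurable_walk => e; exact: (measurable_entry stdG).
exists (fun t => expsum beta (X t) `^ alpha); split.
- have mS : measurable_fun [set: p.-tuple R] (fun z => expsum beta z `^ alpha).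
    exact: (measurableT_comp (measurable_powR alpha) (measurable_expsum beta)).
  exact: (measurableT_comp mS mX).
- by move=> t; exact: powR_ge0.
- have -> : (\int[P]_t (expsum beta (X t) `^ alpha)%:E =
      gmean (map a es) (softmax alpha beta) x0)%E.
    apply: integral_walk.
    + by move=> e; exact: (measurable_entry stdG).
    + exact: upper_pairs_uniq.
    + exact: (entry_indep stdG).
    + exact: measurable_softmax.
    + exact: softmax_ge0.
  set J := gmean _ _ _.
  (* [<u,w>^2 + 1 >= 2 <u,w>]: adding an independent standard normal variable
     to [u^T G u] makes it comparable with [sqrt 2 <g, u>], and on the level of
     exponential moments that variable only costs a factor [exp (tau^2 / 2)]. *)
  pose lX := map a es ++ [:: fun=> 1].
  pose lY := [seq (fun k => Num.sqrt 2 * (u k *m B^T) 0 j) | j <- enum 'I_(\dim V)].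
  have covX k l : cov lX k l = dotr (u k) (u l) ^+ 2 + 1.
    rewrite /cov big_cat big_seq1 mul1r big_map; congr (_ + 1).
    transitivity (\sum_i \sum_j (u k 0 i * u l 0 i) * (u k 0 j * u l 0 j)).
      rewrite (symmetric_sum (f := fun i j => (u k 0 i * u l 0 i) * (u k 0 j * u l 0 j))).
        by apply: eq_bigr => e _; rewrite /a; ring.
      by move=> i j; rewrite mulrC.
    by rewrite expr2 /dotr mulr_suml; apply: eq_bigr => i _; rewrite mulr_sumr.
  have covY k l : cov lY k l = 2 * dotr (u k) (u l).
    rewrite /cov big_map big_enum/= (BE _ _ (uS k).1) mulr_sumr.
    apply: eq_bigr => j _; rewrite mulrACA -expr2 sqr_sqrtr//.
  have covE k : cov lX k k = cov lY k k.
    by rewrite covX covY (uS k).2; ring.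
  have cov_le k l : cov lY k l <= cov lX k l.
    by rewrite covX covY -subr_ge0 (_ : _ - _ = (dotr (u k) (u l) - 1) ^+ 2);
      [exact: sqr_ge0|ring].
  have sY : size lY = \dim V by rewrite size_map size_enum_ord.
  have := slepian_softmax beta p0 a0 a1 x0 covE cov_le.
  rewrite gmean_ones// abE -/J => H1.
  have H2 : (gmean lY (softmax alpha beta) x0 <= (p%:R `^ alpha *
      expR (tau * Num.sqrt (2 * (\dim V)%:R) + tau ^+ 2))%:E)%E.
    rewrite -abE -sY; apply: gmean_softmax_le => //; first by rewrite sY.
    move=> k; apply: (@le_trans _ _ (cov lY k k)).
      by rewrite /cov; apply: ler_sum => b _; rewrite expr2.
    by rewrite covY (uS k).2 mulr1.
  have ge0 : (0 <= (expR (- (tau ^+ 2 / 2)))%:E)%E by rewrite lee_fin expR_ge0.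
  have H3 := lee_wpmul2l ge0 (le_trans H1 H2).
  move: H3; rewrite muleA -EFinM -expRD addNr expR0 mul1e => /le_trans; apply.
  rewrite -EFinM lee_fin mulrCA -expRD.
  apply: (@le_trans _ _ (expR eta * expR (- (tau ^+ 2 / 2) +
      (tau * Num.sqrt (2 * (\dim V)%:R) + tau ^+ 2)))).
    by rewrite ler_wpM2r ?expR_ge0.
  by rewrite -expRD ler_expR le_eqVlt; apply/orP; left; apply/eqP; field.
- move=> t v c vV; apply: (qform_net (ltW delta0) _ net _ vV).
    by move=> k; case: (uS k).
  move=> k; rewrite -XE.
  have expX : expR (tau * tnth (X t) k) <= expsum beta (X t) `^ alpha.
    rewrite -abE (mulrC alpha) -mulrA mulrCA mulrC expRM.
    apply: ge0_ler_powR; rewrite ?nnegrE ?expR_ge0 ?(ltW a0)//.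
      by apply/ltW/expsum_gt0.
    rewrite /expsum (bigD1 k)//= lerDl.
    by apply: sumr_ge0 => l _; exact: expR_ge0.
  rewrite -lerBlDl ler_pdivlMr//.
  have H1 := expR_ge1Dx (tau * (tnth (X t) k - c)).
  have H2 : expR (tau * (tnth (X t) k - c)) <=
      expsum beta (X t) `^ alpha * expR (- (tau * c)).
    by rewrite mulrBr expRD ler_wpM2r ?expR_ge0.
  have := le_trans H1 H2; lra.
Qed.

End subspace_bound.

(** * Union over the subspaces *)

Section width_bound.
Context (R : realType) d (T : measurableType d) (P : probability T R).

(** The integral of a nonnegative function is a supremum over simple functions below it, hence
    monotone without measurability; positive and negative parts are then compared separately. *)
Lemma le_integral_nonmeasurable (f g : T -> \bar R) :
  (forall t, f t <= g t)%E -> (\int[P]_t f t <= \int[P]_t g t)%E.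
Proof.
have ge0_le (f1 f2 : T -> \bar R) : (forall t, 0 <= f1 t)%E ->
    (forall t, f1 t <= f2 t)%E -> (\int[P]_t f1 t <= \int[P]_t f2 t)%E.
  move=> f10 f12; rewrite !ge0_integralTE//; last first.
    by move=> t; exact: le_trans (f12 t).
  apply: le_ereal_sup => _ [h /= hf <-]; exists h => //= t.
  exact: le_trans (hf t) (f12 t).
move=> fg; rewrite integralE [leRHS]integralE leeB//; apply: ge0_le => // t.
- by rewrite !funeposE ge_max !le_max fg/= lexx orbT.
- by rewrite !funenegE ge_max !le_max leeN2 fg/= lexx orbT.
Qed.

Lemma integral_le_dominated (f : T -> \bar R) (H : T -> R) (c b : R) :
  measurable_fun setT H -> (forall t, 0 <= H t) ->
  (\int[P]_t (H t)%:E <= b%:E)%E -> (forall t, f t <= (c + H t)%:E)%E ->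
  (\int[P]_t f t <= (c + b)%:E)%E.
Proof.
move=> mH H0 Hb fle; apply: le_trans (le_integral_nonmeasurable fle) _.
have iH : P.-integrable setT (EFin \o H).
  apply/integrableP; split; first exact/measurable_EFinP.
  under eq_integral do rewrite /= ger0_norm//.
  by rewrite (le_lt_trans Hb)// ltry.
have ic : P.-integrable setT (EFin \o cst c) by exact: finite_measure_integrable_cst.
under eq_integral do rewrite EFinD.
rewrite (integralD measurableT ic iH) /= integral_cst//.
by rewrite [X in (_ * X + _)%E](probability_setT P) mule1 EFinD leeD2l.
Qed.

Lemma integral_sumZ_le (I : eqType) (r : seq I) (f : I -> T -> R) (k b : R) :
  0 <= k -> (forall i, measurable_fun setT (f i)) -> (forall i t, 0 <= f i t) ->
  (forall i, i \in r -> (\int[P]_t (f i t)%:E <= b%:E)%E) ->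
  (\int[P]_t (\sum_(i <- r) k * f i t)%:E <= (\sum_(i <- r) k * b)%:E)%E.
Proof.
move=> k0 mf f0 fb; under eq_integral do rewrite -sumEFin.
rewrite ge0_integral_sum//; last 2 first.
- by move=> i; apply/measurable_EFinP; exact: measurable_funM.
- by move=> i t _; rewrite lee_fin mulr_ge0.
rewrite -sumEFin big_seq [leRHS]big_seq; apply: lee_sum => i ir.
under eq_integral do rewrite EFinM.
rewrite (ge0_integralZl P measurableT).
- by rewrite EFinM; apply: lee_wpmul2l; [rewrite lee_fin|exact: fb].
- exact/measurable_EFinP.
- by move=> t _; rewrite lee_fin.
- by rewrite lee_fin.
Qed.

Lemma normr_le_expR (y : R) : `|y| <= expR y + expR (- y).
Proof.
have := expR_ge1Dx y; have := expR_ge1Dx (- y).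
have := expR_ge0 y; have := expR_ge0 (- y); case: (ger0P y); lra.
Qed.

(** For [v = s^2 / 2 <= 1/2] one has [exp v <= 1 / (1 - v) <= 1 + 2 v]. It bounds the mean of the
    trace term after subtraction of [1 / s]. *)
Lemma expR_sqr_half_le (s : R) : 0 < s -> s <= 1 ->
  expR (s ^+ 2 / 2) / s <= s^-1 + s.
Proof.
move=> s0 s1; rewrite ler_pdivrMr// mulrDl mulVf ?gt_eqF// -expr2.
have s2 : s ^+ 2 <= 1 by rewrite exprn_ile1// ltW.
have s2' : 0 <= s ^+ 2 by exact: sqr_ge0.
set v := s ^+ 2 / 2.
have v1 : 0 < 1 - v by rewrite /v; lra.
have H : expR v * (1 - v) <= 1.
  rewrite -[leRHS](expRxMexpNx_1 v) ler_wpM2l ?expR_ge0//.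
  by have := expR_ge1Dx (- v); lra.
rewrite -(ler_pM2r v1) (le_trans H)//.
have -> : s ^+ 2 = 2 * v by rewrite /v; field.
have : 0 <= v * (1 - 2 * v) by rewrite mulr_ge0// /v; lra.
lra.
Qed.

Variables (n k N : nat) (V : 'I_N -> {vspace 'rV[R]_n}) (G : T -> 'M[R]_n).
Hypotheses (n_gt0 : (0 < n)%N) (k_gt0 : (0 < k)%N) (N_gt0 : (0 < N)%N).
Hypotheses (dimV : forall i, \dim (V i) = k) (stdG : std_gaussian_sym P G).

(* The supremum is dominated through [y <= c + (exp (tau (y - c)) - 1) / tau], which
   turns the maximum over the subspaces into a sum of exponential moments, and
   the trace term through [- y <= (exp (- s y) - 1) / s]. *)
Lemma width_le (tau eps : R) : 0 < tau -> 0 < eps ->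
  (gaussian_width P G (BH (dual_cone (kpsd_cone V))) <=
   (Num.sqrt (2 * k%:R) + tau / 2 + ln N%:R / tau + eps)%:E)%E.
Proof.
move=> tau0 eps0.
pose es := upper_pairs n.
pose A : R := \sum_(e <- es) 4 * expR (1 / 2).
have A0 : 0 <= A by apply: sumr_ge0 => e _; rewrite mulr_ge0 ?expR_ge0.
(* The errors of [softmax] ([eta / tau]), of the net ([2 delta A]) and of the trace ([s]) are each
   at most [eps / 3]; also [s <= 1], as [expR_sqr_half_le] requires. *)
pose eta := tau * eps / 3.
pose delta := eps / (6 * (A + 1)).
pose s := eps / (3 + eps).
have eta0 : 0 < eta by rewrite divr_gt0// mulr_gt0.
have delta0 : 0 < delta by rewrite divr_gt0// mulr_gt0//; lra.
have s0 : 0 < s by rewrite divr_gt0//; lra.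
have s1 : s <= 1 by rewrite ler_pdivrMr; lra.
have s3 : s <= eps / 3.
  by rewrite ler_pdivrMr ?ler_pdivlMr//; [nra|lra].
(* Chosen so that [N exp (- tau c)] times the moment bound is 1: the summed exponentials then have
   mean at most [1 / tau], which cancels the [- 1 / tau] of the linearisation. *)
pose c := Num.sqrt (2 * k%:R) + tau / 2 + (ln N%:R + eta) / tau.
have Sex i := subspace_bound stdG (V := V i) (tau := tau) (eta := eta)
  (delta := delta) (eq_ind_r (fun m => (0 < m)%N) k_gt0 (dimV i)) tau0 eta0 delta0.
pose S i := sval (cid (Sex i)).
have mS i : measurable_fun setT (S i) by rewrite /S; case: cid => ? [].
have S0 i t : 0 <= S i t by rewrite /S; case: cid => ? [].
have intS i : (\int[P]_t (S i t)%:E <=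
    (expR (eta + tau * Num.sqrt (2 * k%:R) + tau ^+ 2 / 2))%:E)%E.
  by rewrite /S; case: cid => ? [] /=; rewrite dimV.
have qS i t v : v \in V i -> qform (G t) v <=
      (c + (S i t * expR (- (tau * c)) - 1) / tau +
        2 * delta * \sum_i \sum_j `|G t i j|) * dotr v v.
  by rewrite /S; case: cid => ? [] /= _ _ _ H vV; exact: H.
pose K := expR (- (tau * c)) / tau.
have K0 : 0 <= K by rewrite divr_ge0 ?expR_ge0// ltW.
pose H1 t := \sum_(i < N) K * S i t.
pose f2 e t := expR (1 * entry G e t) + expR (- 1 * entry G e t).
(* The net error carries [2 delta]; a further 2 bounds the [pair_scale e] left over when the other
   one is absorbed into [entry]. *)
pose H2 t := \sum_(e <- es) 4 * delta * f2 e t.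
pose f3 (i : 'I_n) t := expR (- s * entry G (i, i) t).
pose H3 t := \sum_(i < n) (n%:R * s)^-1 * f3 i t.
have mexp r e : measurable_fun setT (fun t => expR (r * entry G e t)).
  apply: measurableT_comp => //; apply: measurable_funM => //.
  exact: (measurable_entry stdG).
have mf2 e : measurable_fun setT (f2 e) by apply: measurable_funD; exact: mexp.
have f20 e t : 0 <= f2 e t by rewrite addr_ge0 ?expR_ge0.
have ns0 : 0 <= (n%:R * s)^-1 by rewrite invr_ge0 mulr_ge0// ltW.
have d40 : 0 <= 4 * delta by rewrite mulr_ge0// ltW.
have mH1 : measurable_fun setT H1.
  by apply: measurable_sum => i; exact: measurable_funM.
have mH2 : measurable_fun setT H2.
  by apply: measurable_sum => e; exact: measurable_funM.
have mH3 : measurable_fun setT H3.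
  by apply: measurable_sum => i; apply: measurable_funM => //; exact: mexp.
have H10 t : 0 <= H1 t by apply: sumr_ge0 => i _; rewrite mulr_ge0.
have H20 t : 0 <= H2 t by apply: sumr_ge0 => i _; rewrite mulr_ge0.
have H30 t : 0 <= H3 t by apply: sumr_ge0 => i _; rewrite mulr_ge0 ?expR_ge0.
have N0 : 0 < N%:R :> R by rewrite ltr0n.
have nR0 : 0 < n%:R :> R by rewrite ltr0n.
have I1 : (\int[P]_t (H1 t)%:E <= (tau^-1)%:E)%E.
  apply: le_trans (integral_sumZ_le K0 mS S0 (fun i _ => intS i)) _.
  rewrite lee_fin sumr_const card_ord -[X in X *+ _]mulr1 -mulrnAr.
  rewrite le_eqVlt; apply/orP; left; apply/eqP.
  rewrite -{1}(lnK N0) /K -[X in _ = X]mul1r.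
  transitivity (expR (- (tau * c)) * expR (eta + tau * Num.sqrt (2 * k%:R) +
    tau ^+ 2 / 2) * expR (ln N%:R) / tau); first by ring.
  congr (_ / _); rewrite -!expRD -[RHS]expR0; congr expR.
  by rewrite /c; field; rewrite gt_eqF.
have I2 : (\int[P]_t (H2 t)%:E <= (2 * delta * A)%:E)%E.
  have f2b e : e \in es -> (\int[P]_t (f2 e t)%:E <= (2 * expR (1 / 2))%:E)%E.
    rewrite mem_filter => /andP[le_e _].
    under eq_integral do rewrite EFinD.
    rewrite ge0_integralD//; last 2 first.
    - by apply/measurable_EFinP; exact: mexp.
    - by apply/measurable_EFinP; exact: mexp.
    rewrite !(integral_entry_expR stdG _ le_e) -EFinD lee_fin.
    by rewrite sqrrN expr1n; lra.
  apply: le_trans (integral_sumZ_le d40 mf2 f20 f2b) _.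
  rewrite lee_fin /A mulr_sumr; apply: ler_sum => e _; lra.
have I3 : (\int[P]_t (H3 t)%:E <= (s^-1 + s)%:E)%E.
  have f3b i : i \in index_enum 'I_n ->
      (\int[P]_t (f3 i t)%:E <= (expR (s ^+ 2 / 2))%:E)%E.
    by move=> _; rewrite (integral_entry_expR stdG (e := (i, i)) _ (leqnn i)) sqrrN.
  apply: le_trans (integral_sumZ_le ns0 _ _ f3b) _.
  - by move=> i; exact: mexp.
  - by move=> i t; exact: expR_ge0.
  rewrite lee_fin sumr_const card_ord -mulr_natl.
  apply: le_trans (expR_sqr_half_le s0 s1).
  rewrite le_eqVlt; apply/orP; left; apply/eqP; field.
  by rewrite !gt_eqF.
pose H t := H1 t + H2 t + H3 t.
have mH : measurable_fun setT H.
  by apply: measurable_funD => //; exact: measurable_funD.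
have H0 t : 0 <= H t by rewrite !addr_ge0.
have IH : (\int[P]_t (H t)%:E <= (tau^-1 + 2 * delta * A + (s^-1 + s))%:E)%E.
  rewrite /H; under eq_integral do rewrite 2!EFinD.
  have mE (f : T -> R) : measurable_fun setT f ->
      measurable_fun setT (fun t => (f t)%:E) by move=> mf; exact/measurable_EFinP.
  have E0 (f : T -> R) : (forall t, 0 <= f t) ->
      forall t, setT t -> (0 <= (f t)%:E)%E by move=> f0 t _; rewrite lee_fin.
  have E12 t : setT t -> (0 <= (H1 t)%:E + (H2 t)%:E)%E.
    by move=> _; apply: adde_ge0; rewrite lee_fin.
  have m12 : measurable_fun setT (fun t => (H1 t)%:E + (H2 t)%:E)%E.
    by apply: emeasurable_funD; apply: mE.
  rewrite (ge0_integralD P measurableT E12 m12 (E0 H3 H30) (mE H3 mH3)).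
  rewrite (ge0_integralD P measurableT (E0 H1 H10) (mE H1 mH1) (E0 H2 H20) (mE H2 mH2)).
  rewrite (EFinD _ (s^-1 + s)) (EFinD tau^-1).
  by apply: leeD; [apply: leeD; [exact: I1|exact: I2]|exact: I3].
(* The constants [- 1 / tau] and [- 1 / s] stay outside [H], which must be nonnegative for
   [integral_le_dominated]. *)
have key t : (ereal_sup [set (trip (G t) X)%:E |
    X in BH (dual_cone (kpsd_cone V))] <= (c - tau^-1 - s^-1 + H t)%:E)%E.
  apply: ge_ereal_sup => _ [X BX <-]; rewrite lee_fin.
  have symG : symmx (G t) by case: stdG.
  have GH2 : 2 * delta * (\sum_i \sum_j `|G t i j|) <= H2 t.
    rewrite (symmetric_sum (f := fun i j => `|G t i j|)); last first.
      by move=> i j; rewrite -{1}symG mxE.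
    rewrite mulr_sumr; apply: ler_sum => e _.
    have ps0 := pair_scale_gt0 R e.
    have ps2 : pair_scale R e <= 2.
      rewrite /pair_scale; case: ifP => _; first by rewrite ler1n.
      rewrite -[leRHS]ger0_norm// -sqrtr_sqr ler_wsqrtr//.
      by rewrite expr2; lra.
    have abs_le : `|entry G e t| <= f2 e t.
      by rewrite /f2 mul1r mulN1r; exact: normr_le_expR.
    have -> : 2 * delta * (pair_scale R e ^+ 2 * `|G t e.1 e.2|) =
        2 * delta * (pair_scale R e * `|entry G e t|).
      by rewrite /entry normrM (gtr0_norm ps0); ring.
    have -> : 4 * delta * f2 e t = 2 * delta * (2 * f2 e t) by ring.
    apply: ler_wpM2l; first by rewrite mulr_ge0// ltW.
    by apply: ler_pM => //; exact: ltW.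
  have trG : - (n%:R^-1 * \tr (G t)) <= H3 t - s^-1.
    have -> : H3 t - s^-1 = \sum_(i < n) (n%:R * s)^-1 * (f3 i t - 1).
      under [RHS]eq_bigr do rewrite mulrBr mulr1.
      rewrite sumrB; congr (_ - _).
      rewrite sumr_const card_ord -[RHS]mulr_natl.
      by field; rewrite !gt_eqF.
    rewrite /mxtrace mulr_sumr -sumrN; apply: ler_sum => i _.
    have := expR_ge1Dx (- s * entry G (i, i) t).
    rewrite -/(f3 i t) /entry /pair_scale eqxx mul1r /= => le1.
    have -> : - (n%:R^-1 * G t i i) = (n%:R * s)^-1 * (- s * G t i i).
      by field; rewrite !gt_eqF.
    by apply: ler_wpM2l => //; lra.
  have lamP i v : v \in V i -> qform (G t) v <=
      (c - tau^-1 + H1 t + H2 t) * dotr v v.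
    move=> /(qS i t)/le_trans; apply; apply: ler_wpM2r; first exact: dotr_ge0.
    have KS : K * S i t <= H1 t.
      rewrite /H1 (bigD1 i)//= lerDl.
      by apply: sumr_ge0 => j _; rewrite mulr_ge0.
    have -> : (S i t * expR (- (tau * c)) - 1) / tau = K * S i t - tau^-1.
      by rewrite /K; field; rewrite gt_eqF.
    lra.
  have := trip_BH_le symG lamP BX; rewrite /H; lra.
apply: le_trans (integral_le_dominated mH H0 IH key) _.
rewrite lee_fin.
have dA : 2 * delta * A <= eps / 3.
  rewrite /delta mulrA mulrAC ler_pdivrMr; last lra.
  by rewrite -subr_ge0 (_ : _ - _ = 2 * eps); [lra|field].
have -> : c = Num.sqrt (2 * k%:R) + tau / 2 + ln N%:R / tau + eps / 3.
  by rewrite /c /eta; field; rewrite gt_eqF.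
lra.
Qed.

End width_bound.

Theorem theorem1 (R : realType) (n k N : nat) (V : 'I_N -> {vspace 'rV[R]_n})
  (d : measure_display) (T : measurableType d) (P : probability T R)
  (G : T -> 'M[R]_n) :
  (1 <= n)%N -> (1 <= k <= n)%N -> (1 <= N)%N ->
  injective V -> (forall i, \dim (V i) = k) ->
  std_gaussian_sym P G ->
  (gaussian_width P G (BH (dual_cone (kpsd_cone V)))
     <= (Num.sqrt (2 * k%:R) + Num.sqrt (2 * ln N%:R))%:E)%E.
Proof.
move=> n0 /andP[k0 _] N0 _ dimV stdG.
apply/lee_addgt0Pr => e e0; rewrite -EFinD.
(* For [N = 1] the optimal [tau] would be 0, which [width_le] excludes; a small positive value is
   used instead. *)
have [N1|N1] := leqP N 1.
  have e2 : 0 < e / 2 by rewrite divr_gt0.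
  apply: le_trans (width_le n0 k0 N0 dimV stdG e2 e2) _.
  have -> : N = 1 by apply/eqP; rewrite eqn_leq N1.
  by rewrite lee_fin ln1 mulr0 sqrtr0 mul0r; lra.
have lnN : 0 < ln N%:R :> R by rewrite ln_gt0// ltr1n.
(* The minimiser of [tau / 2 + ln N / tau], where the two terms are equal. *)
pose tau : R := Num.sqrt (2 * ln N%:R).
have tau0 : 0 < tau by rewrite sqrtr_gt0 mulr_gt0.
apply: le_trans (width_le n0 k0 N0 dimV stdG tau0 e0) _.
rewrite lee_fin -/tau lerD2r -addrA lerD2l.
have -> : ln N%:R = tau ^+ 2 / 2 by rewrite sqr_sqrtr ?mulr_ge0 ?ltW//; field.
by rewrite le_eqVlt; apply/orP; left; apply/eqP; field; rewrite gt_eqF.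
Qed.
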